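(* Let $\mathcal{M}$ be a generic collection of $m$ lines in $\mathbb{P}^n$ with $m\ge 2$, and let $R$ be the coordinate ring of $\mathcal{M}$. (a) If $m$ is even and $m+1\le n$, then $R$ has a Koszul filtration. (b) If $m$ is odd and $m+2\le n$, then $R$ has a Koszul filtration. In particular, in both cases $R$ is Koszul.
   Context: Let $\mathbb{P}^n$ be projective $n$-space over $\mathbb{C}$ with homogeneous coordinate ring $S=\mathbb{C}[x_0,\ldots,x_n]$ (standard grading). The defining ideal of a line in $\mathbb{P}^n$ is the ideal of $S$ of all forms vanishing on it; it is minimally generated by $n-1$ linear forms. For a collection $\mathcal{M}=\{\mathcal{L}_1,\ldots,\mathcal{L}_m\}$ of lines with defining ideals $L_1,\ldots,L_m$, the defining ideal of $\mathcal{M}$ is $J=\bigcap_{i=1}^m L_i$ and the coordinate ring of $\mathcal{M}$ is $R=S/J$. The collection $\mathcal{M}$ is a generic collection if the lines are defined by linear forms ($n-1$ linear forms generating each $L_i$) whose coefficients, all taken together, are algebraically independent over $\mathbb{Q}$. A standard graded $\mathbb{C}$-algebra $R$ is Koszul if $\mathbb{C}=R/\mathfrak{m}_R$ (with $\mathfrak{m}_R$ the maximal homogeneous ideal) has a linear free resolution over $R$, i.e. $\mathrm{Tor}_i^R(\mathbb{C},\mathbb{C})_j=0$ for all $i\neq j$. A family $\mathcal{F}$ of ideals of a standard graded $\mathbb{C}$-algebra $R$ is a Koszul filtration of $R$ if: (1) every ideal $I\in\mathcal{F}$ is generated by linear forms; (2) the ideal $0$ and the ideal $\mathfrak{m}_R$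 belong to $\mathcal{F}$; (3) for every $I\in\mathcal{F}$ with $I\neq 0$ there exists $K\in\mathcal{F}$ such that $K\subset I$, $I/K$ is cyclic, and $K:I\in\mathcal{F}$. *)

(* Defs.v *)
From HB Require Import structures.
From mathcomp Require Import all_boot all_order all_algebra.
From mathcomp Require Import boolp classical_sets.
From mathcomp Require Import generic_quotient ring_quotient mpoly.

Set Implicit Arguments.
Unset Strict Implicit.
Unset Printing Implicit Defensive.

Import GRing.Theory.
Local Open Scope ring_scope.
Local Open Scope classical_set_scope.
Local Open Scope quotient_scope.

Section Ideals.
Variable A : comNzRingType.
Implicit Types (X I K : set A).

Definition ideal_gen X : set A :=
  [set x | exists (k : nat) (c g : 'I_k -> A),
     (forall i, X (g i)) /\ x = \sum_(i < k) c i * g i].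

Definition colon K I : set A := [set r | forall x, I x -> K (r * x)].

Definition cyclic_quotient I K : Prop :=
  exists2 x, I x & I = ideal_gen (K `|` [set x]).

End Ideals.

Section GradedRings.
Variables (A : comNzRingType) (gr : nat -> set A).

Definition maximal_homog_ideal : set A :=
  ideal_gen [set x | exists2 d, (0 < d)%N & gr d x].

Definition koszul_filtration (F : set (set A)) : Prop :=
  [/\ forall I, F I -> exists2 X, X `<=` gr 1 & I = ideal_gen X,
      F [set 0] /\ F maximal_homog_ideal
    & forall I, F I -> I <> [set 0] ->
        exists K, [/\ F K, K `<=` I, cyclic_quotient I K & F (colon K I)]].

(* The resolution is  ... -> A(-2)^(b 2) -> A(-1)^(b 1) -> A^(b 0) -> A/m -> 0
   with b 0 = 1, the last map being the canonical projection.  Elements of the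
   free modules are row vectors, on which d i acts by right multiplication;
   d i is homogeneous of degree 0 from A(-i-1)^(b i.+1) to A(-i)^(b i) exactly
   when its entries are in gr 1.  The second condition is exactness at A^(b 0),
   the last one exactness at A(-i-1)^(b i.+1). *)
Definition linear_free_resolution
    (b : nat -> nat) (d : forall i, 'M[A]_(b i.+1, b i)) : Prop :=
  [/\ b 0 = 1%N,
      forall i k l, gr 1 (d i k l),
      forall v : 'rV[A]_(b 0),
        (forall k, maximal_homog_ideal (v 0 k)) <-> (exists w, v = w *m d 0)
    & forall i (v : 'rV[A]_(b i.+1)),
        v *m d i = 0 <-> (exists w, v = w *m d i.+1)].

Definition koszul : Prop := exists b d, @linear_free_resolution b d.

End GradedRings.

Section Lines.
Variables (K : fieldType) (n : nat).

Record line := Line {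
  line_space : {vspace 'rV[K]_n.+1};
  dim_line_space : \dim line_space = 2 }.

(* Homogeneous coordinates of points are the nonzero vectors. *)
Definition line_ideal (L : line) : set {mpoly K[n.+1]} :=
  ideal_gen [set f | (exists d, f \is d.-homog) /\
    forall v : 'rV[K]_n.+1, v \in line_space L -> v != 0 ->
      f.@[fun j => v 0 j] = 0].

Definition linear_form (v : 'rV[K]_n.+1) : {mpoly K[n.+1]} :=
  \sum_(j < n.+1) v 0 j *: 'X_j.

Lemma line_has_point (L : line) :
  exists2 v : 'rV[K]_n.+1, v \in line_space L & v != 0.
Proof.
exists (vpick (line_space L)); first exact: memv_pick.
by rewrite vpick0 -dimv_eq0 dim_line_space.
Qed.

Lemma line_ideal0 (L : line) : line_ideal L 0.
Proof.
exists 0%N, (fun=> 0), (fun=> 0); split; first by case.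
by rewrite big_ord0.
Qed.

Lemma line_idealD (L : line) f g :
  line_ideal L f -> line_ideal L g -> line_ideal L (f + g).
Proof.
case=> [p [c [x [hx ->]]]] [q [e [y [hy ->]]]].
exists (p + q)%N, (fun i => match split i with inl i => c i | inr i => e i end),
  (fun i => match split i with inl i => x i | inr i => y i end); split.
  by move=> i; case: (split i).
rewrite big_split_ord /=; congr (_ + _); apply: eq_bigr => i _.
  by rewrite (unsplitK (inl i)).
by rewrite (unsplitK (inr i)).
Qed.

Lemma line_idealMl (L : line) a f : line_ideal L f -> line_ideal L (a * f).
Proof.
case=> [p [c [x [hx ->]]]]; exists p, (fun i => a * c i), x; split=> //.
by rewrite mulr_sumr; apply: eq_bigr => i _; rewrite mulrA.
Qed.

Lemma line_ideal1 (L : line) : ~ line_ideal L 1.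
Proof.
case=> [p [c [x [hx e]]]]; have [v vL v0] := line_has_point L.
have /eqP := congr1 (meval (fun j => v 0 j)) e.
rewrite meval1 raddf_sum /= big1 ?oner_eq0 // => i _.
by rewrite mevalM (hx i).2 ?mulr0.
Qed.

End Lines.

Section Collections.
Variables (K : fieldType) (m n : nat).

(* The hypothesis 0 < m is what makes the quotient a nonzero ring: it is used
   only by the ideal structure below. *)
Definition collection_ideal (m_gt0 : (0 < m)%N) (M : 'I_m -> line K n) :
    {pred {mpoly K[n.+1]}} :=
  fun f => `[< forall i, line_ideal (M i) f >].

Lemma collection_ideal_closed (m_gt0 : (0 < m)%N) (M : 'I_m -> line K n) :
  idealr_closed (collection_ideal m_gt0 M).
Proof.
split.
- by apply/asboolP => i; apply: line_ideal0.
- by apply/asboolP => /(_ (Ordinal m_gt0)); apply: line_ideal1.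
move=> a f g /asboolP hf /asboolP hg; apply/asboolP => i.
by apply: line_idealD => //; apply: line_idealMl.
Qed.

HB.instance Definition _ (m_gt0 : (0 < m)%N) (M : 'I_m -> line K n) :=
  isIdealr.Build {mpoly K[n.+1]} (collection_ideal m_gt0 M)
    (collection_ideal_closed m_gt0 M).

Definition coordinate_ring (m_gt0 : (0 < m)%N) (M : 'I_m -> line K n) :
    comNzRingType :=
  {ideal_quot (collection_ideal m_gt0 M)}.

Definition coordinate_ring_gr (m_gt0 : (0 < m)%N) (M : 'I_m -> line K n)
    (d : nat) : set (coordinate_ring m_gt0 M) :=
  [set x | exists2 f : {mpoly K[n.+1]},
     f \is d.-homog & x = \pi_{ideal_quot (collection_ideal m_gt0 M)} f].

End Collections.

Definition alg_independent_over_rat (K : numFieldType) (T : finType)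
    (a : T -> K) : Prop :=
  forall p : {mpoly rat[#|T|]},
    mmap (ratr : rat -> K) (fun i => a (enum_val i)) p = 0 -> p = 0.

(* a i is the matrix of coefficients of n - 1 linear forms defining M i. *)
Definition generic_collection (K : numFieldType) (m n : nat)
    (M : 'I_m -> line K n) : Prop :=
  exists a : 'I_m -> 'M[K]_(n.-1, n.+1),
    alg_independent_over_rat
      (fun t : 'I_m * 'I_n.-1 * 'I_n.+1 => a t.1.1 t.1.2 t.2) /\
    forall i, line_ideal (M i) =
      ideal_gen [set linear_form (row k (a i)) | k in [set: 'I_n.-1]].

(* Main.v *)
(* Write R as a ring of functions on the lines: restricting to line i gives
   phi_i : R -> P = K[X_0, X_1], and the phi_i are jointly injective.  Split the
   lines into two halves of sizes floor(m/2) and ceil(m/2).  By genericity, each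
   half together with any single line of the other half spans a space of the
   maximal dimension; this is where m + 1 <= n (resp. m + 2 <= n) enters.  Hence
   there are linear forms w_0, w_1 vanishing on one half and restricting to
   coordinates on every line of the other half.  Since R_1 surjects onto the
   linear forms of each half, (w_0, w_1) contains everything that vanishes on the
   first half and is of degree >= 2 on the second.  This makes all the colon
   ideals explicit, and a Koszul filtration consists of the ideals of initial
   segments of a list spanning the linear forms that vanish on one half, together
   with the ideals obtained by adding to that list some coordinates x_{i,b} of the
   lines i of that half.  Genericity itself is the nonvanishing of a determinant
   with rational coefficients, tested on coordinate lines. *)
Require Import Defs.
From HB Require Import structures.
From mathcomp Require Import all_boot all_order all_algebra.
From mathcomp Require Import boolp classical_sets reals complex.
From mathcomp Require Import generic_quotient ring_quotient mpoly ring zify.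

Set Implicit Arguments.
Unset Strict Implicit.
Unset Printing Implicit Defensive.

Import GRing.Theory.
Local Open Scope ring_scope.
Local Open Scope quotient_scope.

(** * Linear quotients and linear resolutions *)

Section SpanOfSeq.
Variables (A : comNzRingType) (V : lmodType A).
Implicit Types (l : seq V) (u v x : V) (a : A).

(** Coefficients are indexed by [nat], so that one family [c] serves for a list, its prefixes and
    its extensions. *)
Definition mspan l v := exists c : nat -> A, v = \sum_(i < size l) c i *: l`_i.

Lemma mspan_nil v : mspan [::] v <-> v = 0.
Proof.
split=> [[c ->]|->]; first by rewrite big_ord0.
by exists (fun=> 0); rewrite big_ord0.
Qed.

Lemma mspan_cat l1 l2 v :
  mspan (l1 ++ l2) v <->
  exists c : nat -> A, mspan l1 (v - \sum_(i < size l2) c i *: l2`_i).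
Proof.
split=> [[c ->]|[c [d e]]].
  exists (fun i => c (size l1 + i)%N), c.
  rewrite size_cat big_split_ord /= [X in _ + X - _](_ : _ =
     \sum_(i < size l2) c (size l1 + i)%N *: l2`_i).
    rewrite addrK; apply: eq_bigr => i _; by rewrite nth_cat ltn_ord.
  by apply: eq_bigr => i _; rewrite nth_cat ltnNge leq_addr /= addKn.
exists (fun i => if (i < size l1)%N then d i else c (i - size l1)%N).
rewrite size_cat big_split_ord /=.
move/eqP: e; rewrite subr_eq => /eqP ->; congr (_ + _); apply: eq_bigr => i _.
  by rewrite nth_cat ltn_ord.
by rewrite nth_cat ltnNge leq_addr /= addKn.
Qed.

Lemma mspan_rcons l x v :
  mspan (rcons l x) v <-> exists a, mspan l (v - a *: x).
Proof.
rewrite -cats1 mspan_cat /=; split=> [[c]|[a h]].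
  by rewrite big_ord1 /=; exists (c 0%N).
by exists (fun=> a); rewrite big_ord1.
Qed.

Lemma mspan0 l : mspan l 0.
Proof. by exists (fun=> 0); rewrite big1 // => i _; rewrite scale0r. Qed.

Lemma mspanD l u v : mspan l u -> mspan l v -> mspan l (u + v).
Proof.
case=> [c ->] [d ->]; exists (fun i => c i + d i).
by rewrite -big_split; apply: eq_bigr => i _; rewrite scalerDl.
Qed.

Lemma mspanZ l a v : mspan l v -> mspan l (a *: v).
Proof.
case=> [c ->]; exists (fun i => a * c i).
by rewrite scaler_sumr; apply: eq_bigr => i _; rewrite scalerA.
Qed.

Lemma mspanN l v : mspan l v -> mspan l (- v).
Proof. by rewrite -scaleN1r; apply: mspanZ. Qed.

Lemma mspan_sum l (I : Type) (r : seq I) (P : pred I) (F : I -> V) :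
  (forall i, P i -> mspan l (F i)) -> mspan l (\sum_(i <- r | P i) F i).
Proof.
move=> h; elim/big_ind: _ => //; first exact: mspan0.
by move=> x y; apply: mspanD.
Qed.

Lemma mspan_mem l x : x \in l -> mspan l x.
Proof.
move=> xl; exists (fun i => (i == index x l)%:R).
have hi : (index x l < size l)%N by rewrite index_mem.
rewrite (bigD1 (Ordinal hi)) //= eqxx scale1r nth_index // big1 ?addr0 // => i.
by rewrite -val_eqE /= => /negPf ->; rewrite scale0r.
Qed.

Lemma mspan_sub l l' v :
  (forall x, x \in l -> mspan l' x) -> mspan l v -> mspan l' v.
Proof.
move=> h [c ->]; apply: mspan_sum => i _; apply: mspanZ; apply: h.
exact: mem_nth.
Qed.

Definition rows_mx n (l : seq 'rV[A]_n) : 'M[A]_(size l, n) :=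
  \matrix_(i < size l) l`_i.

Lemma mulmx_rows_mx n (l : seq 'rV[A]_n) (v : 'rV_(size l)) :
  v *m rows_mx l = \sum_(i < size l) v 0 i *: l`_i.
Proof. by rewrite mulmx_sum_row; apply: eq_bigr => i _; rewrite rowK. Qed.

(** The list form of the colon condition of a Koszul filtration. It is stated in a module so as to
    cover generators of syzygies as well as of ideals. *)
Definition linear_quotients (G : seq A -> Prop) l :=
  forall i, (i < size l)%N -> exists2 ys, G ys &
    forall a, mspan (take i l) (a *: l`_i) <->
              exists c : nat -> A, a = \sum_(j < size ys) c j * ys`_j.

End SpanOfSeq.

Lemma mspan_rows_mx (A : comNzRingType) n (l : seq 'rV[A]_n) (v : 'rV[A]_n) :
  (exists w, v = w *m rows_mx l) <-> mspan l v.
Proof.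
split=> [[w ->]|[c ->]].
  rewrite mulmx_rows_mx; exists (fun i => if insub i is Some j then w 0 j else 0).
  by apply: eq_bigr => i _; rewrite valK.
exists (\row_i c i); rewrite mulmx_rows_mx.
by apply: eq_bigr => i _; rewrite mxE.
Qed.

(** * Linear resolutions from linear quotients *)

Section Resolution.
Variables (A : comNzRingType) (gr : nat -> set A) (G : seq A -> Prop).
(** These stand for the projections of [A] onto its components of degrees 1 and 2. *)
Variables p1 p2 : A -> A.
Hypothesis p2D : {morph p2 : a b / a + b}.
Hypothesis p2M : forall a y, gr 1%N y -> p2 (a * y) = p1 a * y.
Hypothesis gr1_p1 : forall a, gr 1%N (p1 a).
Hypothesis p1_id : forall a, gr 1%N a -> p1 a = a.
Hypothesis gr1_0 : gr 1%N 0.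
Hypothesis G_gr : forall ys y, G ys -> y \in ys -> gr 1%N y.
Hypothesis G_quot : forall ys, G ys -> linear_quotients (V := A^o) G ys.

Notation linear_rows l := (forall x, x \in l -> forall k, gr 1%N (x 0 k)).

(** The entries of the rows are linear, so the degree 2 component of the relation involves only the
    linear part of [v]. *)
Lemma linear_syzygy q (l : seq 'rV[A]_q) (v : 'rV_(size l)) :
  linear_rows l -> v *m rows_mx l = 0 ->
  map_mx p1 v *m rows_mx l = 0.
Proof.
move=> lin e; apply/rowP => k.
have p20 : p2 0 = 0 by apply: (addrI (p2 0)); rewrite -p2D !addr0.
move/rowP/(_ k)/(congr1 p2): e; rewrite !mulmx_rows_mx !mxE p20 => <-.
rewrite !summxE (big_morph p2 p2D p20); apply: eq_bigr => i _.
by rewrite !mxE p2M //; apply: lin; apply: mem_nth.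
Qed.

(* The syzygies supported on the first r coordinates have, by induction on r,
   linear quotients: their r-th coordinates run over a colon ideal, and the
   generators of that ideal lift to linear syzygies. *)
Lemma syzygies_upto q (l : seq 'rV[A]_q) r :
    linear_quotients G l -> linear_rows l -> (r <= size l)%N ->
  exists l' : seq 'rV[A]_(size l), [/\ linear_quotients G l', linear_rows l' &
    forall v, mspan l' v <-> v *m rows_mx l = 0 /\
                            forall j : 'I_(size l), (r <= j)%N -> v 0 j = 0].
Proof.
move=> lq lin; elim: r => [_|r IHr r_lt].
  exists [::]; split=> // v; rewrite mspan_nil; split=> [->|[_ h]].
    by rewrite mul0mx; split=> // j _; rewrite mxE.
  by apply/rowP => j; rewrite mxE h.
have [l' [lq' lin' l'P]] := IHr (ltnW r_lt).
have [ys Gys ysP] := lq _ r_lt.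
pose j0 := Ordinal r_lt.
have lift y : exists u : 'rV[A]_(size l), y \in ys ->
    [/\ u *m rows_mx l = 0, forall j : 'I_(size l), (r < j)%N -> u 0 j = 0,
        u 0 j0 = y & forall k, gr 1%N (u 0 k)].
  have [yys|] := boolP (y \in ys); last by exists 0.
  have /ysP[c ec] := @mspan_mem _ A^o _ _ yys.
  (* The expression of [y *: l_r] through the earlier rows, read as a syzygy. Its linear part is
     still a syzygy and keeps the linear form [y] in position [r]. *)
  pose u : 'rV[A]_(size l) :=
    \row_j (if (j < r)%N then - c j else if j == j0 then y else 0).
  have u0 : u *m rows_mx l = 0.
    rewrite mulmx_rows_mx (bigD1 j0) //= mxE ltnn eqxx ec.
    rewrite size_takel; last exact: ltnW.
    rewrite (big_ord_widen_cond _ xpredT (fun i => c i *: (take r l)`_i) (ltnW r_lt)).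
    rewrite [X in _ + X](bigID (fun i : 'I_(size l) => (i < r)%N)) /=.
    rewrite [X in _ + (_ + X)]big1 ?addr0 => [|i /andP[/negPf ne /negPf lt]].
      rewrite [X in _ + X](eq_bigl (fun i : 'I_(size l) => (i < r)%N)) => [|i].
        rewrite -big_split big1 // => i lt; rewrite mxE lt nth_take //.
        by rewrite scaleNr; exact: subrr.
      by rewrite -val_eqE /= andb_idl // neq_ltn => ->.
    by rewrite mxE lt ne scale0r.
  exists (map_mx p1 u) => _; split.
  - exact: linear_syzygy.
  - move=> j jr; rewrite !mxE ltnNge (ltnW jr) /= -val_eqE /= gtn_eqF //.
    exact: p1_id.
  - by rewrite !mxE ltnn eqxx p1_id //; apply: G_gr Gys _.
  - by move=> k; rewrite mxE.
have [f fP] := choice lift.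
have fnth i : (i < size ys)%N -> (map f ys)`_i = f ys`_i.
  by move=> ilt; rewrite (nth_map 0).
have combP (c : nat -> A) k (u := \sum_(i < k) c i *: (map f ys)`_i) :
    (k <= size ys)%N ->
    [/\ u *m rows_mx l = 0, forall j : 'I_(size l), (r < j)%N -> u 0 j = 0 &
        u 0 j0 = \sum_(i < k) c i * ys`_i].
  move=> kle; have fi (i : 'I_k) := fP _ (mem_nth 0 (leq_trans (ltn_ord i) kle)).
  have lti (i : 'I_k) := leq_trans (ltn_ord i) kle.
  split.
  - rewrite mulmx_suml big1 // => i _; rewrite -scalemxAl fnth //.
    by have [-> _ _ _] := fi i; rewrite scaler0.
  - move=> j jr; rewrite summxE big1 // => i _; rewrite mxE fnth //.
    by have [_ h _ _] := fi i; rewrite (h j jr) mulr0.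
  - rewrite summxE; apply: eq_bigr => i _; rewrite mxE fnth //.
    by have [_ _ -> _] := fi i.
have low v : (v *m rows_mx l = 0 /\ forall j : 'I_(size l), (r < j)%N -> v 0 j = 0) ->
    v 0 j0 = 0 -> mspan l' v.
  case=> v0 vj vj0; apply/l'P; split=> // j; rewrite leq_eqVlt => /predU1P[e|].
    by rewrite -[j](_ : j0 = j) //; apply: val_inj.
  exact: vj.
exists (l' ++ map f ys); split.
- move=> i; rewrite size_cat size_map => ilt.
  have [il'|l'i] := ltnP i (size l').
    have [zs Gzs zsP] := lq' _ il'; exists zs => // a.
    by rewrite takel_cat ?(ltnW il') // nth_cat il'.
  (* For a generator beyond [l'], membership in the span of the predecessors is decided by
     coordinate [r], where it becomes a question about [ys], which itself has linear quotients. *)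
  have [k ek] : exists k, i = (size l' + k)%N by exists (i - size l')%N; rewrite subnKC.
  move: ilt; rewrite ek ltn_add2l => klt.
  have [zs Gzs zsP] := G_quot Gys klt; exists zs => // a; rewrite -zsP.
  rewrite take_cat nth_cat ltnNge leq_addr /= addKn fnth // -map_take mspan_cat.
  have [fk0 fkj fkj0 _] := fP _ (mem_nth 0 klt).
  have sz : size (take k ys) = k by rewrite size_takel // ltnW.
  have takeE (c : nat -> A) :
      \sum_(i < k) c i *: (map f (take k ys))`_i = \sum_(i < k) c i *: (map f ys)`_i.
    by apply: eq_bigr => j _; rewrite map_take nth_take.
  have takeE1 (c : nat -> A) :
      \sum_(i < k) c i * (take k ys)`_i = \sum_(i < k) c i * ys`_i.
    by apply: eq_bigr => j _; rewrite nth_take.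
  rewrite size_map sz; split=> -[c]; have [c1 c2 c3] := combP c k (ltnW klt).
    rewrite takeE => /l'P [_ /(_ j0 (leqnn _))].
    rewrite [LHS]mxE [X in _ + X]mxE c3 mxE fkj0 => /eqP.
    by rewrite subr_eq0 => /eqP e; exists c; rewrite sz [RHS]takeE1.
  rewrite sz [X in _ = X]takeE1 => e; exists c; rewrite takeE.
  apply: low; first split.
  - by rewrite mulmxBl c1 -scalemxAl fk0 scaler0 subrr.
  - by move=> j jr; rewrite [LHS]mxE [X in _ + X]mxE c2 // mxE fkj // mulr0 subrr.
  by rewrite [LHS]mxE [X in _ + X]mxE c3 mxE fkj0 [X in X - _]e subrr.
- move=> x; rewrite mem_cat => /orP[|/mapP[y yys ->]]; first exact: lin'.
  by have [] := fP _ yys.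
move=> v; rewrite mspan_cat size_map; split.
  case=> c /l'P[v1 v2]; have [c1 c2 c3] := combP c _ (leqnn _).
  split=> [|j jr].
    by move/eqP: v1; rewrite mulmxBl c1 subr0 => /eqP.
  by move: (v2 j (ltnW jr)); rewrite [LHS]mxE [X in _ + X]mxE c2 // subr0.
case=> v1 v2.
(* Solving the relation for its term of index [r] puts [v 0 j0] in the colon ideal generated by
   [ys]. *)
have /ysP[c ec] : mspan (take r l) (v 0 j0 *: l`_r).
  have e : v 0 j0 *: l`_r = - \sum_(i < size l | (i < r)%N) v 0 i *: l`_i.
    apply/eqP; rewrite -addr_eq0; apply/eqP; rewrite -{}[RHS]v1 mulmx_rows_mx.
    rewrite [RHS](bigD1 j0) //=; congr (_ + _).
    rewrite [RHS](bigID (fun i : 'I_(size l) => (i < r)%N)) /=.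
    rewrite [X in _ + X]big1 ?addr0 => [|i].
      apply: eq_bigl => i; rewrite -val_eqE /= andb_idl // neq_ltn => -> //.
    rewrite -val_eqE /= -leqNgt => /andP[ne le]; rewrite v2 ?scale0r //.
    by rewrite ltn_neqAle eq_sym ne.
  rewrite e; apply/mspanN/mspan_sum => i ir; apply: mspanZ; apply: mspan_mem.
  by rewrite -(nth_take 0 ir) mem_nth // size_takel // ltnW.
exists c; have [c1 c2 c3] := combP c _ (leqnn _); apply: low; first split.
- by rewrite mulmxBl c1 v1 subrr.
- by move=> j jr; rewrite [LHS]mxE [X in _ + X]mxE c2 // v2 // subrr.
by rewrite [LHS]mxE [X in _ + X]mxE c3 ec subrr.
Qed.

Lemma syzygies_linear_quotients q (l : seq 'rV[A]_q) :
    linear_quotients G l -> linear_rows l ->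
  exists l' : seq 'rV[A]_(size l), [/\ linear_quotients G l', linear_rows l' &
    forall v, v *m rows_mx l = 0 <-> mspan l' v].
Proof.
move=> lq lin; have [l' [lq' lin' h]] := syzygies_upto lq lin (leqnn _).
exists l'; split=> // v; rewrite h; split=> [?|[]//]; split=> // j.
by rewrite leqNgt ltn_ord.
Qed.

(** The row length changes at each step of the resolution, so it is packed with the rows and their
    two invariants. *)
Record stage := Stage {
  stage_rank : nat;
  stage_rows : seq 'rV[A]_stage_rank;
  stage_quot : linear_quotients G stage_rows;
  stage_lin : linear_rows stage_rows }.

Lemma next_stage (s : stage) : exists l' : seq 'rV[A]_(size (stage_rows s)),
  [/\ linear_quotients G l', linear_rows l' &
    forall v, v *m rows_mx (stage_rows s) = 0 <-> mspan l' v].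
Proof. exact: syzygies_linear_quotients (@stage_quot s) (@stage_lin s). Qed.

(** The generators of the maximal ideal, as rows of length 1, start an iteration in which each stage
    generates the syzygies of the preceding one; the resulting matrices are the differentials. *)
Lemma koszul_of_linear_quotients ys :
  G ys -> (forall a, maximal_homog_ideal gr a <-> mspan (V := A^o) ys a) ->
  koszul gr.
Proof.
move=> Gys ysP.
pose l0 : seq 'rV[A]_1 := map (fun y => const_mx y) ys.
have l0E (c : nat -> A) k : (k <= size ys)%N ->
    \sum_(i < k) c i *: l0`_i = const_mx (\sum_(i < k) c i * ys`_i).
  move=> kle; apply/rowP => j; rewrite mxE summxE; apply: eq_bigr => i _.
  by rewrite (nth_map 0) ?mxE // (leq_trans (ltn_ord i)).
have cinj : injective (fun y : A => const_mx y : 'rV[A]_1).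
  by move=> a b /rowP/(_ 0); rewrite !mxE.
have lq0 : linear_quotients G l0.
  move=> i; rewrite size_map => ilt; have [zs Gzs zsP] := G_quot Gys ilt.
  exists zs => // a; rewrite -zsP (nth_map 0) // /mspan.
  have sz : size (take i ys) = i by rewrite size_takel // ltnW.
  rewrite -map_take size_map sz map_take.
  have ev (c : nat -> A) : \sum_(j < i) c j *: (take i l0)`_j =
              const_mx (\sum_(j < i) c j * (take i ys)`_j) :> 'rV[A]_1.
    transitivity (\sum_(j < i) c j *: l0`_j).
      by apply: eq_bigr => j _; rewrite nth_take.
    rewrite l0E; last exact: ltnW.
    by congr const_mx; apply: eq_bigr => j _; rewrite nth_take.
  have ez : a *: const_mx ys`_i = const_mx (a * ys`_i) :> 'rV[A]_1.
    by apply/rowP => j; rewrite !mxE.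
  rewrite ez; split=> -[c e]; exists c.
    by apply: cinj; rewrite /= -ev.
  by rewrite ev; congr const_mx.
have lin0 : linear_rows l0.
  by move=> _ /mapP[y yys ->] k; rewrite mxE; apply: G_gr Gys _.
pose nx s := projT1 (cid (next_stage s)).
have nxP s : _ := projT2 (cid (next_stage s)).
have nx_quot s : linear_quotients G (nx s) by case: (nxP s).
have nx_lin s : linear_rows (nx s) by case: (nxP s).
pose st i := iter i (fun s => Stage (nx_quot s) (nx_lin s)) (Stage lq0 lin0).
exists (fun i => stage_rank (st i)), (fun i => rows_mx (stage_rows (st i))).
split=> //.
- move=> i k l; rewrite mxE; apply: (@stage_lin (st i)); exact: mem_nth.
- move=> v; rewrite (mspan_rows_mx l0); split.
    move=> /(_ 0)/ysP[c ec]; exists c; rewrite size_map l0E //.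
    by apply/rowP => j; rewrite mxE ord1 ec.
  case=> c ->; rewrite size_map l0E // => k; rewrite mxE; apply/ysP.
  by exists c.
move=> i v; have [_ _ ->] := nxP (st i).
by rewrite -(mspan_rows_mx (nx (st i))).
Qed.

End Resolution.

(** * Koszul filtrations from linear quotients *)

Notation idspan := (@mspan _ (_)^o).

Lemma idspanM (A : comNzRingType) (l : seq A) a b : idspan l b -> idspan l (a * b).
Proof. exact: mspanZ. Qed.

Lemma idspan_mem (A : comNzRingType) (l : seq A) a : a \in l -> idspan l a.
Proof. exact: (@mspan_mem A A^o). Qed.

Lemma idspanD (A : comNzRingType) (l : seq A) a b :
  idspan l a -> idspan l b -> idspan l (a + b).
Proof. exact: (@mspanD A A^o). Qed.

Lemma idspan_sub (A : comNzRingType) (l l' : seq A) a :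
  (forall y, y \in l -> idspan l' y) -> idspan l a -> idspan l' a.
Proof. exact: (@mspan_sub A A^o). Qed.

Lemma idspan_gen (A : comNzRingType) (l : seq A) :
  ideal_gen (fun y => y \in l) = idspan l :> set A.
Proof.
apply/funext => a; apply/propext; split=> [[k [c [g [gl ->]]]]|[c ->]].
  by apply: mspan_sum => i _; apply: idspanM; exact: idspan_mem (gl i).
by exists (size l), c, (fun i => l`_i); split=> // i; apply: mem_nth.
Qed.

Section LinearQuotientsFiltration.
Variables (A : comNzRingType) (gr : nat -> set A) (G : seq A -> Prop).
Hypothesis G_gr : forall ys y, G ys -> y \in ys -> gr 1%N y.
Hypothesis G_quot : forall ys, G ys -> linear_quotients (V := A^o) G ys.
Hypothesis G_take : forall i ys, G ys -> G (take i ys).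

(** Dropping the last entry of a nonempty list gives the smaller ideal with cyclic quotient. *)
Lemma koszul_filtration_of_linear_quotients ys :
  G ys -> (forall a, maximal_homog_ideal gr a <-> idspan ys a) ->
  koszul_filtration gr [set J | exists2 zs, G zs & J = idspan zs].
Proof.
move=> Gys ysP; split.
- move=> J [zs Gzs ->]; exists (fun y => y \in zs); last by rewrite idspan_gen.
  by move=> y; apply: G_gr.
- split; last by exists ys => //; apply/funext => a; apply/propext.
  exists [::]; first by rewrite -(take0 ys); apply: G_take.
  by apply/funext => a; apply/propext; rewrite mspan_nil.
move=> J [zs Gzs ->]; case/lastP: zs Gzs => [_ []|zs x Gzs _].
  by apply/funext => a; apply/propext; rewrite mspan_nil.
have zs_lt : (size zs < size (rcons zs x))%N by rewrite size_rcons.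
have [us Gus usP] := G_quot Gzs zs_lt.
move: usP; rewrite nth_rcons ltnn eqxx -cats1 take_size_cat // => usP.
exists (idspan zs); split.
- exists zs => //; have := G_take (size zs) Gzs.
  by rewrite -cats1 take_size_cat.
- by move=> a; apply: mspan_sub => y yz; apply: idspan_mem; rewrite mem_cat yz.
- exists x; first by apply: idspan_mem; rewrite mem_cat mem_head orbT.
  apply/funext => a; apply/propext; split.
    rewrite cats1 mspan_rcons => -[b [c e]].
    exists (size zs).+1, (fun i => if unlift ord_max i is Some j then c j else b),
      (fun i => if unlift ord_max i is Some j then zs`_j else x); split.
      move=> i; case: unliftP => [j _|_]; last by right.
      by left; apply: idspan_mem; apply: mem_nth.
    rewrite big_ord_recr /= unlift_none; move/eqP: e; rewrite subr_eq => /eqP ->.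
    by congr (_ + _); apply: eq_bigr => i _;
    rewrite (_ : widen_ord _ i = lift ord_max i) ?liftK //; apply/val_inj/esym/lift_max.
  case=> k [c [g [gP ->]]]; apply: mspan_sum => i _; apply: idspanM.
  case: (gP i) => [|->]; last by apply: idspan_mem; rewrite mem_cat mem_head orbT.
  by apply: mspan_sub => y yz; apply: idspan_mem; rewrite mem_cat yz.
exists us => //; apply/funext => r; apply/propext; rewrite /colon /=; split=> h.
  by apply/usP; apply: h; apply: idspan_mem; rewrite mem_cat mem_head orbT.
(* Modulo the smaller ideal every element of the larger one is a multiple of [x], so only the
   product [r * x] has to be tested. *)
move=> y; rewrite cats1 mspan_rcons => -[b hb].
rewrite -[y](subrK (b * x)) mulrDr; apply: mspanD; first exact: idspanM.
by rewrite mulrCA; apply: idspanM; apply/usP.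
Qed.

End LinearQuotientsFiltration.

(** * Morphisms of polynomial rings and homogeneous components *)

Section MPolyMod.
Variables (n : nat) (R : comNzRingType).

Lemma mpoly_ring_ind (Q : {mpoly R[n]} -> Prop) :
    (forall c, Q c%:MP) -> (forall i, Q 'X_i) ->
    (forall p q, Q p -> Q q -> Q (p + q)) ->
    (forall p q, Q p -> Q q -> Q (p * q)) ->
  forall p, Q p.
Proof.
move=> QC QX QD QM p; have Q1 : Q 1 by rewrite -mpolyC1.
have Q0 : Q 0 by rewrite -(mpolyC0 n R).
rewrite [p]mpolyE; elim/big_ind: _ => // m _.
rewrite -mul_mpolyC; apply: (QM) => //.
rewrite mpolyXE_id; elim/big_ind: _ => // i _.
by elim: (m i) => [|k IH]; rewrite ?expr0 ?exprS //; apply: QM.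
Qed.

(** Congruence modulo an ideal is compatible with sums and products, so it propagates from the
    variables. *)
Lemma rmorph_mpoly_mod (A : comNzRingType) (f g : {rmorphism {mpoly R[n]} -> A})
    (l : seq A) :
  (forall c, f c%:MP = g c%:MP) -> (forall i, idspan l (f 'X_i - g 'X_i)) ->
  forall p, idspan l (f p - g p).
Proof.
move=> hC hX; elim/mpoly_ring_ind => // [c|p q hp hq|p q hp hq].
- by rewrite hC subrr; apply: mspan0.
- by rewrite !rmorphD opprD addrACA; apply: mspanD.
rewrite !rmorphM -[_ - _](subrKA (f p * g q)) -mulrBr -mulrBl.
by apply: mspanD; [|rewrite mulrC]; apply: idspanM.
Qed.

Lemma rmorph_mpoly_eq (A : comNzRingType) (f g : {rmorphism {mpoly R[n]} -> A}) :
  (forall c, f c%:MP = g c%:MP) -> (forall i, f 'X_i = g 'X_i) -> f =1 g.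
Proof.
move=> hC hX p; apply/eqP; rewrite -subr_eq0; apply/eqP.
apply/(@mspan_nil A A^o); apply: rmorph_mpoly_mod => // i.
by rewrite hX subrr; apply: mspan0.
Qed.

(** The normal form modulo the variables in [T]; its vanishing is the membership test for the ideal
    they generate. *)
Definition kill (T : pred 'I_n) : {mpoly R[n]} -> {mpoly R[n]} :=
  mmap (@mpolyC n R) (fun b => if T b then 0 else 'X_b).
HB.instance Definition _ T := GRing.RMorphism.copy (kill T)
  (mmap (@mpolyC n R) (fun b => if T b then 0 else 'X_b)).

Lemma killC T c : kill T c%:MP = c%:MP.
Proof. exact: mmapC. Qed.

Lemma killX T b : kill T 'X_b = if T b then 0 else 'X_b.
Proof. by rewrite /kill mmapX mmap1U. Qed.

Lemma kill_id (T : pred _) p : (forall b, ~~ T b) -> kill T p = p.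
Proof.
move=> hT; apply: (@rmorph_mpoly_eq _ (kill T) idfun) => /= [c|b]; first by rewrite killC.
by rewrite killX (negPf (hT b)).
Qed.

Lemma kill_cst (T : pred _) p : (forall b, T b) -> kill T p = (p@_0)%:MP.
Proof.
move=> hT; pose g : {rmorphism {mpoly R[n]} -> {mpoly R[n]}} :=
  (@mpolyC n R) \o (mcoeff 0%MM).
apply: (@rmorph_mpoly_eq _ (kill T) g) => /= [c|b]; first by rewrite killC mpolyCK.
by rewrite killX hT mcoeffX -mdeg_eq0 mdeg1 mpolyC0.
Qed.

Lemma cst_kill T p : (kill T p)@_0 = p@_0.
Proof.
apply: (@rmorph_mpoly_eq _ (mcoeff 0%MM \o kill T) (mcoeff 0%MM)) => [c|b] /=.
  by rewrite killC.
by rewrite killX; case: ifP => // _; rewrite mcoeff0 mcoeffX -mdeg_eq0 mdeg1.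
Qed.

Lemma kill_span (T : pred _) p (l : seq {mpoly R[n]}) :
  kill T p = 0 -> (forall b, T b -> 'X_b \in l) -> idspan l p.
Proof.
move=> p0 hl; rewrite -[p]subr0 -p0.
apply: (@rmorph_mpoly_mod _ idfun (kill T)) => /= [c|b]; first by rewrite killC.
rewrite killX; case: ifP => [/hl Tb|_]; first by rewrite subr0; apply: idspan_mem.
by rewrite subrr; apply: mspan0.
Qed.

Lemma homog_cst d (p : {mpoly R[n]}) : (0 < d)%N -> p \is d.-homog -> p@_0 = 0.
Proof.
move=> d_gt0 hp; apply: (dhomog_nemf_coeff hp).
by rewrite /= mdeg0 eq_sym -lt0n.
Qed.

Lemma homog1_sum (p : {mpoly R[n]}) : p \is 1.-homog -> p = \sum_(i < n) p@_U_(i) *: 'X_i.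
Proof.
move=> hp; apply/mpolyP => m; rewrite raddf_sum /=.
have [/mdeg1P[i /eqP ->]|m1] := boolP (mdeg m == 1%N).
  rewrite (bigD1 i) //= mcoeffZ mcoeffX eqxx mulr1 big1 ?addr0 // => j ji.
  rewrite mcoeffZ mcoeffX; case: eqP => [/mnmP/(_ j)|_]; last by rewrite mulr0.
  by rewrite !mnm1E eqxx eq_sym (negPf ji).
rewrite (dhomog_nemf_coeff hp) // big1 // => i _.
rewrite mcoeffZ mcoeffX; case: eqP => [e|_]; last by rewrite mulr0.
by rewrite -e mdeg1 eqxx in m1.
Qed.

Lemma rmorph_homog k (f : {rmorphism {mpoly R[n]} -> {mpoly R[k]}}) d p :
    (forall c, f c%:MP = c%:MP) -> (forall i, f 'X_i \is 1.-homog) ->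
  p \is d.-homog -> f p \is d.-homog.
Proof.
move=> fC fX /dhomogP hp; rewrite [p]mpolyE raddf_sum /= big_seq.
apply: rpred_sum => m /hp <-; rewrite -mul_mpolyC rmorphM fC mul_mpolyC.
apply: rpredZ; rewrite mpolyXE_id rmorph_prod /= mdegE.
elim/big_ind2: _ => [|p1 d1 p2 d2|i _]; first exact: dhomog1.
  exact: dhomogM.
by rewrite rmorphXn; have := dhomogMn (m i) (fX i); rewrite mul1n.
Qed.

Lemma mpoly_homog_split (p : {mpoly R[n]}) d :
  exists2 k, (d < k)%N & p = \sum_(e < k) pihomog mdeg e p.
Proof.
exists (maxn (msize p) d.+1); first by rewrite leq_maxr.
by apply: pihomog_partitionE; rewrite leq_maxl.
Qed.

Lemma rmorph_pihomog k (f : {rmorphism {mpoly R[n]} -> {mpoly R[k]}}) d p :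
    (forall c, f c%:MP = c%:MP) -> (forall i, f 'X_i \is 1.-homog) ->
  f (pihomog mdeg d p) = pihomog mdeg d (f p).
Proof.
move=> fC fX; have [e de ep] := mpoly_homog_split p d.
have hf i := rmorph_homog fC fX (pihomogP mdeg i p).
set g := LHS; rewrite ep !raddf_sum (bigD1 (Ordinal de)) //= [X in _ + X]big1.
  by rewrite addr0 [RHS]pihomog_dE; last exact: (hf d).
by move=> i ne; apply: pihomog_ne0 (hf i).
Qed.

(** A linear factor raises degrees by exactly one, so only the linear part of [f] contributes in
    degree 2. *)
Lemma pihomogM1 (f g : {mpoly R[n]}) :
  g \is 1.-homog -> pihomog mdeg 2 (f * g) = pihomog mdeg 1 f * g.
Proof.
move=> hg; have [k k1 ef] := mpoly_homog_split f 1.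
set h := RHS; rewrite ef mulr_suml raddf_sum (bigD1 (Ordinal k1)) //= [X in _ + X]big1 => [|i ne].
  by rewrite addr0 pihomog_dE //; apply: dhomogM (pihomogP _ _ _) hg.
apply: (@pihomog_ne0 _ _ _ (i + 1)%N); last by apply: dhomogM (pihomogP _ _ _) hg.
by rewrite addn1 eqSS.
Qed.

End MPolyMod.

(** * The filtration *)

(** Greedy choice: an entry of [cs] is kept only if it is outside the ideal of [l0] and the entries
    kept before. *)
Lemma irredundant_subseq (A : comNzRingType) (l0 cs : seq A) :
  exists e, [/\ {subset e <= cs}, forall y, y \in cs -> idspan (l0 ++ e) y &
    forall i, (i < size e)%N -> ~ idspan (l0 ++ take i e) e`_i].
Proof.
elim/last_ind: cs => [|cs y [e [esub ecs eP]]]; first by exists [::].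
have sub z : z \in e -> z \in rcons cs y.
  by rewrite mem_rcons inE => /esub ->; rewrite orbT.
have [hy|hy] := pselect (idspan (l0 ++ e) y).
  exists e; split=> // z; rewrite mem_rcons inE => /predU1P[->//|]; exact: ecs.
exists (rcons e y); split.
- by move=> z; rewrite mem_rcons inE mem_rcons inE; case: eqP => //= _; apply: esub.
- move=> z; rewrite mem_rcons inE -rcons_cat => /predU1P[->|/ecs].
    by apply: idspan_mem; rewrite mem_rcons mem_head.
  apply: idspan_sub => u ul; apply: idspan_mem; by rewrite mem_rcons inE ul orbT.
move=> i; rewrite size_rcons ltnS leq_eqVlt => /predU1P[->|ilt].
  by rewrite -cats1 take_size_cat // nth_cat ltnn subnn.
by rewrite -cats1 takel_cat ?(ltnW ilt) // nth_cat ilt; apply: eP.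
Qed.

Section Filtration.
Variables (K : fieldType) (N : nat) (A : comNzRingType) (I : finType).
Notation P := {mpoly K[2]}.
(** [A] is an abstract coordinate ring, presented by [pi]; [phi i] is restriction to line [i], with
    two coordinates. *)
Variables (pi : {rmorphism {mpoly K[N]} -> A}) (phi : I -> {rmorphism A -> P}).
Hypothesis pi_surj : forall a, exists f, a = pi f.
Hypothesis phi_inj : forall a b, (forall i, phi i a = phi i b) -> a = b.
Hypothesis phiC : forall i c, phi i (pi c%:MP) = c%:MP.
Hypothesis phiX : forall i l, phi i (pi 'X_l) \is 1.-homog.

Definition graded_part (d : nat) : set A :=
  [set a | exists2 f : {mpoly K[N]}, f \is d.-homog & a = pi f].
Notation gr := graded_part.

Variable side : I -> bool.
(** Each [w s] serves all lines opposite to side [s] simultaneously, whereas [x i] is adapted to the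
    single line [i] within its own side; on the opposite side [x i] restricts to arbitrary linear
    forms. *)
Variables (w : bool -> 'I_2 -> A) (x : I -> 'I_2 -> A).
Hypothesis side_ne : forall s, exists i, side i = s.
Hypothesis gr_w : forall s b, gr 1%N (w s b).
Hypothesis gr_x : forall i b, gr 1%N (x i b).
Hypothesis phi_w0 : forall s b i, side i = s -> phi i (w s b) = 0.
Hypothesis phi_w : forall s b i, side i = ~~ s -> phi i (w s b) = 'X_b.
Hypothesis phi_x : forall i b, phi i (x i b) = 'X_b.
Hypothesis phi_x0 : forall i j b,
  i != j -> side i = side j -> phi j (x i b) = 0.

Lemma phi_homog i d f : f \is d.-homog -> phi i (pi f) \is d.-homog.
Proof.
pose g : {rmorphism {mpoly K[N]} -> P} := phi i \o pi.
exact: (@rmorph_homog _ _ _ g d f (phiC i) (phiX i)).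
Qed.

Lemma phi_pihomog i d f :
  phi i (pi (pihomog mdeg d f)) = pihomog mdeg d (phi i (pi f)).
Proof.
pose g : {rmorphism {mpoly K[N]} -> P} := phi i \o pi.
exact: (@rmorph_pihomog _ _ _ g d f (phiC i) (phiX i)).
Qed.

Lemma phi_gr d i a : gr d a -> phi i a \is d.-homog.
Proof. by case=> f hf ->; apply: phi_homog. Qed.

Lemma gr0 d : gr d 0.
Proof. by exists 0; [apply: rpred0|rewrite rmorph0]. Qed.

Lemma grD d a b : gr d a -> gr d b -> gr d (a + b).
Proof.
case=> f hf -> [g hg ->]; exists (f + g); last by rewrite rmorphD.
exact: dhomogD.
Qed.

Lemma grN d a : gr d a -> gr d (- a).
Proof. by case=> f hf ->; exists (- f); [rewrite dhomogN|rewrite rmorphN]. Qed.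

Lemma grC d c a : gr d a -> gr d (pi c%:MP * a).
Proof.
case=> f hf ->; exists (c *: f); first exact: dhomogZ.
by rewrite -mul_mpolyC rmorphM.
Qed.

(** Constant terms are values at the origin, which is common to the cones over all lines. *)
Lemma cst_phi i j a : (phi i a)@_0 = (phi j a)@_0.
Proof.
have [f ->] := pi_surj a.
pose g k : {rmorphism {mpoly K[N]} -> K} := mcoeff 0%MM \o (phi k \o pi).
apply: (@rmorph_mpoly_eq _ _ _ (g i) (g j)) => /= [c|l].
  by rewrite !phiC.
by rewrite !(homog_cst _ (phiX _ _)).
Qed.

(** Components of a representative descend to [A], because the [phi i] commute with taking
    components and are jointly injective. *)
Lemma graded_projection : exists p : nat -> A -> A,
  [/\ forall d, {morph p d : a b / a + b},
      forall a y, gr 1%N y -> p 2 (a * y) = p 1%N a * y,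
      forall d a, gr d (p d a) & forall d a, gr d a -> p d a = a].
Proof.
have [r rP] := choice pi_surj.
pose p d a := pi (pihomog mdeg d (r a)).
have pE d f : p d (pi f) = pi (pihomog mdeg d f).
  by apply: phi_inj => i; rewrite /p !phi_pihomog -rP.
exists p; split.
- move=> d a b; have [[f ->] [g ->]] := (pi_surj a, pi_surj b).
  by rewrite -rmorphD !pE pihomogD rmorphD.
- move=> a _ [g hg ->]; have [f ->] := pi_surj a.
  by rewrite -rmorphM !pE pihomogM1 // rmorphM.
- by move=> d a; exists (pihomog mdeg d (r a)) => //; apply: pihomogP.
by move=> d _ [f hf ->]; rewrite pE pihomog_dE.
Qed.

(** A [K]-algebra section of [phi i]. *)
Definition psi i : P -> A := mmap (pi \o @mpolyC N K) (x i).
HB.instance Definition _ i :=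
  GRing.RMorphism.copy (psi i) (mmap (pi \o @mpolyC N K) (x i)).

Lemma psiC i c : psi i c%:MP = pi c%:MP.
Proof. by rewrite /psi mmapC. Qed.

Lemma psiX i b : psi i 'X_b = x i b.
Proof. by rewrite /psi mmapX mmap1U. Qed.

Lemma phi_psi i p : phi i (psi i p) = p.
Proof.
apply: (@rmorph_mpoly_eq _ _ _ (phi i \o psi i) idfun) => /= [c|b].
  by rewrite psiC phiC.
by rewrite psiX phi_x.
Qed.

Lemma phi_psi0 i j p :
  i != j -> side i = side j -> p@_0 = 0 -> phi j (psi i p) = 0.
Proof.
move=> ij sij p0; rewrite -(mpolyC0 2 K) -p0.
pose g : {rmorphism P -> P} := @mpolyC 2 K \o (mcoeff 0%MM).
apply: (@rmorph_mpoly_eq _ _ _ (phi j \o psi i) g) => /= [c|b].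
  by rewrite psiC phiC mpolyCK.
by rewrite psiX phi_x0 // mcoeffX -mdeg_eq0 mdeg1 mpolyC0.
Qed.

Lemma cst_phi_psi i j p : (phi j (psi i p))@_0 = p@_0.
Proof. by rewrite (cst_phi j i) phi_psi. Qed.

(** Gluing: polynomials without constant term can be prescribed on all lines of one side at once. *)
Lemma phi_sum_psi s (q : I -> P) j :
  side j = s -> (forall i, side i = s -> (q i)@_0 = 0) ->
  phi j (\sum_(i | side i == s) psi i (q i)) = q j.
Proof.
move=> js hq; rewrite (bigD1 j) ?js //= raddfD /= phi_psi raddf_sum big1 ?addr0 //.
by move=> i /andP[/eqP is_ ij]; apply: phi_psi0; rewrite ?is_ // hq.
Qed.

Lemma gr_psi i p : p \is 1.-homog -> gr 1%N (psi i p).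
Proof.
move/homog1_sum ->; rewrite raddf_sum.
elim/big_ind: _ => [|a b|b _]; [exact: gr0|exact: grD|].
by rewrite -mul_mpolyC /= rmorphM /= psiC psiX; apply: grC.
Qed.

Lemma cstM (p q : P) : (p * q)@_0 = p@_0 * q@_0.
Proof. exact: (rmorphM (mcoeff 0%MM : {rmorphism P -> K})). Qed.

(* The square of the irrelevant ideal of P. *)
Definition sqmax (p : P) :=
  exists q : 'I_2 -> P, (forall b, (q b)@_0 = 0) /\ p = \sum_b 'X_b * q b.

Lemma cst0_sum (p : P) : p@_0 = 0 -> exists q : 'I_2 -> P, p = \sum_b 'X_b * q b.
Proof.
move=> p0; have := @kill_span _ _ xpredT p [seq 'X_b | b <- enum 'I_2] _ _.
case=> [|b _|c ->]; first by rewrite kill_cst // p0 mpolyC0.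
  by apply: map_f; rewrite mem_enum.
rewrite size_map size_enum_ord; exists (fun b : 'I_2 => c b).
apply: eq_bigr => b _; rewrite [LHS]mulrC; congr (_ * _).
by rewrite (nth_map b) ?size_enum_ord // nth_ord_enum.
Qed.

Lemma sqmaxM p q : p@_0 = 0 -> q@_0 = 0 -> sqmax (p * q).
Proof.
move=> /cst0_sum[r ->] q0; exists (fun b => r b * q); split=> [b|].
  by rewrite cstM q0 mulr0.
by rewrite mulr_suml; apply: eq_bigr => b _; rewrite mulrA.
Qed.

Lemma sqmax0 : sqmax 0.
Proof.
exists (fun=> 0); split=> [b|]; first by rewrite mcoeff0.
by rewrite big1 // => b _; rewrite mulr0.
Qed.

Lemma sqmaxD p q : sqmax p -> sqmax q -> sqmax (p + q).
Proof.
case=> [f [f0 ->]] [g [g0 ->]]; exists (fun b => f b + g b); split=> [b|].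
  by rewrite raddfD /= f0 g0 addr0.
by rewrite -big_split; apply: eq_bigr => b _; rewrite mulrDr.
Qed.

Lemma sqmaxN p : sqmax p -> sqmax (- p).
Proof.
case=> [f [f0 ->]]; exists (fun b => - f b); split=> [b|].
  by rewrite raddfN /= f0 oppr0.
by rewrite -sumrN; apply: eq_bigr => b _; rewrite mulrN.
Qed.

(** * The ideal of one half of the lines *)

Definition w2 s := [:: w s 0; w s 1].

(** On each opposite line [g] is a combination of the two variables with coefficients free of
    constant terms. These glue over all opposite lines to coefficients of [w s 0] and [w s 1]. *)
Lemma span_w2 s g :
    (forall j, side j = s -> phi j g = 0) ->
    (forall i, side i = ~~ s -> sqmax (phi i g)) -> idspan (w2 s) g.
Proof.
move=> g0 gsq.
have h i : exists q : 'I_2 -> P, side i = ~~ s ->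
    (forall b, (q b)@_0 = 0) /\ phi i g = \sum_b 'X_b * q b.
  have [/eqP e|ne] := boolP (side i == ~~ s).
    by have [q qP] := gsq i e; exists q.
  by exists (fun=> 0) => e; rewrite e eqxx in ne.
have {h}[q qP] := choice h.
pose r b := \sum_(i | side i == ~~ s) psi i (q i b).
suff -> : g = r 0 * w s 0 + r 1 * w s 1.
  apply: mspanD; apply: idspanM; apply: idspan_mem; by rewrite !inE eqxx ?orbT.
apply: phi_inj => i; rewrite rmorphD !rmorphM /=.
have [/eqP e|ne] := boolP (side i == s).
  by rewrite g0 // !phi_w0 // !mulr0 addr0.
have e : side i = ~~ s by move: ne; case: (side i) (s) => [] [].
have [_ ->] := qP i e.
rewrite !phi_w // !phi_sum_psi //; try by move=> j js; have [-> _] := qP j js.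
by rewrite big_ord_recl big_ord1 ![_ * 'X__]mulrC; congr (_ + 'X__ * q i _); apply: val_inj.
Qed.

(** The variable [X_l] corrected by the forms [x j] so as to vanish on side [s]. *)
Definition residue s l :=
  pi 'X_l - \sum_(j | side j == s) psi j (phi j (pi 'X_l)).

Lemma phi_residue s l j : side j = s -> phi j (residue s l) = 0.
Proof.
move=> js; rewrite /residue rmorphB /= phi_sum_psi // ?subrr // => i _.
exact: homog_cst (phiX i l).
Qed.

Lemma gr_residue s l : gr 1%N (residue s l).
Proof.
apply: grD; first by exists 'X_l => //; rewrite dhomogX /= mdeg1.
apply: grN; elim/big_ind: _ => [|a b|j _]; [exact: gr0|exact: grD|exact: gr_psi].
Qed.

Definition residues s := [seq residue s l | l <- enum 'I_N].

(** Constants and variables have this shape, and it is stable under sums and products modulo the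
    ideal. *)
Lemma span_side_decomp s a : exists c (p : I -> P),
  (forall j, (p j)@_0 = 0) /\
  idspan (w2 s ++ residues s)
         (a - (pi c%:MP + \sum_(j | side j == s) psi j (p j))).
Proof.
have [f ->] := pi_surj a; elim/mpoly_ring_ind: f => [c|l|f g|f g].
- exists c, (fun=> 0); split=> [j|]; first by rewrite mcoeff0.
  by rewrite big1 ?addr0 ?subrr => [|j _]; [apply: mspan0|rewrite raddf0].
- exists 0, (fun j => phi j (pi 'X_l)); split=> [j|].
    exact: homog_cst (phiX j l).
  rewrite mpolyC0 rmorph0 add0r; apply: idspan_mem.
  by rewrite mem_cat; apply/orP; right; apply/mapP; exists l => //; rewrite mem_enum.
- case=> [c [p [p0 hp]]] [d [q [q0 hq]]]; exists (c + d), (fun j => p j + q j).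
  split=> [j|]; first by rewrite raddfD /= p0 q0 addr0.
  have -> : \sum_(j | side j == s) psi j (p j + q j) =
     \sum_(j | side j == s) psi j (p j) + \sum_(j | side j == s) psi j (q j).
    by rewrite -big_split; apply: eq_bigr => j _; rewrite raddfD.
  rewrite mpolyCD !rmorphD addrACA opprD addrACA; exact: mspanD.
case=> [c [p [p0 hp]]] [d [q [q0 hq]]].
exists (c * d), (fun j => c *: q j + d *: p j + p j * q j); split=> [j|].
  by rewrite !raddfD /= !mcoeffZ cstM p0 q0 !mulr0 !addr0.
pose S r := \sum_(j | side j == s) psi j (r j).
have -> : \sum_(j | side j == s) psi j (c *: q j + d *: p j + p j * q j) =
    pi c%:MP * S q + pi d%:MP * S p + S (fun j => p j * q j).
  rewrite /S !mulr_sumr -!big_split; apply: eq_bigr => j _.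
  by rewrite !raddfD /= -!mul_mpolyC !rmorphM /= !psiC.
rewrite -/(S p) -/(S q) in hp hq.
(* The difference vanishes on side [s], and on the opposite side it is built from products of two
   factors without constant term, so [span_w2] applies. *)
have cross : idspan (w2 s ++ residues s) (S p * S q - S (fun j => p j * q j)).
  apply: (@idspan_sub _ (w2 s)).
    by move=> y yw; apply: idspan_mem; rewrite mem_cat yw.
  have cst i r : (forall j, (r j)@_0 = 0) -> (phi i (S r))@_0 = 0.
    move=> r0; rewrite !raddf_sum big1 // => j _ /=.
    by rewrite cst_phi_psi.
  apply: span_w2 => i is_; rewrite rmorphB rmorphM /=.
    by rewrite !phi_sum_psi // ?subrr // => j _; rewrite cstM p0 mul0r.
  apply: sqmaxD; first by apply: sqmaxM; apply: cst.
  apply: sqmaxN; rewrite raddf_sum; elim/big_ind: _ => [|? ?|j _].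
  - exact: sqmax0.
  - exact: sqmaxD.
  by rewrite /= !rmorphM /=; apply: sqmaxM; rewrite cst_phi_psi.
rewrite mpolyCM !rmorphM /=.
move: (idspanM (pi g) hp) (idspanM (pi c%:MP + S p) hq) cross.
move: (pi f) (pi g) (pi c%:MP) (pi d%:MP) (S p) (S q) (S (fun j => p j * q j)).
move=> f1 g1 c1 d1 u v t h1 h2 h3.
rewrite (_ : _ - _ = g1 * (f1 - (c1 + u)) + (c1 + u) * (g1 - (d1 + v)) + (u * v - t)).
  by apply: idspanD h3; apply: idspanD.
ring.
Qed.

(** Irredundancy of the kept residues ensures that their colon ideals are not the whole ring. *)
Lemma independent_w s : exists ws e, [/\ ws = w2 s ++ e,
  {subset e <= residues s}, forall y, y \in residues s -> idspan ws y &
  forall i, (i < size e)%N -> ~ idspan (w2 s ++ take i e) e`_i].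
Proof.
have [e [h1 h2 h3]] := irredundant_subseq (w2 s) (residues s).
by exists (w2 s ++ e), e.
Qed.

Definition ws s := projT1 (cid (independent_w s)).

Lemma wsP s : exists e, [/\ ws s = w2 s ++ e, {subset e <= residues s},
  forall y, y \in residues s -> idspan (ws s) y &
  forall i, (i < size e)%N -> ~ idspan (w2 s ++ take i e) e`_i].
Proof. exact: projT2 (cid (independent_w s)). Qed.

Lemma ws_mem s y : y \in ws s -> gr 1%N y /\ forall j, side j = s -> phi j y = 0.
Proof.
have [e [-> esub _ _]] := wsP s.
rewrite mem_cat !inE => /orP[/orP[]/eqP->|/esub/mapP[l _ ->]].
- by split=> // j js; apply: phi_w0.
- by split=> // j js; apply: phi_w0.
by split=> [|j]; [apply: gr_residue|apply: phi_residue].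
Qed.

Definition xs (zs : seq (I * 'I_2)) := [seq x z.1 z.2 | z <- zs].

Definition on_side s (zs : seq (I * 'I_2)) := all (fun z => side z.1 == s) zs.

(** Modulo [ws s] an element is a constant plus contributions of the single lines of side [s], so
    membership is tested line by line against ideals generated by variables. *)
Lemma span_killP s zs a : on_side s zs ->
  idspan (ws s ++ xs zs) a <->
  forall j, side j = s -> kill [pred b | (j, b) \in zs] (phi j a) = 0.
Proof.
move=> /allP zss; split=> [h j js|h].
  set T := [pred b | _].
  have genP y : y \in ws s ++ xs zs -> kill T (phi j y) = 0.
    rewrite mem_cat => /orP[/ws_mem[_ -> //]|]; first by rewrite rmorph0.
    case/mapP => -[k b] kb ->; have [ekj|kj] := eqVneq k j; last first.
      by rewrite phi_x0 ?rmorph0 //= js; apply/eqP/(zss _ kb).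
    by move: kb; rewrite ekj /= phi_x killX /= => ->.
  case: h => c ->; set l := _ ++ _ in genP *.
  rewrite !raddf_sum big1 // => i _ /=.
  by rewrite !rmorphM /= (genP _ (mem_nth 0 (ltn_ord i))) mulr0.
have [c [p [p0 hp]]] := span_side_decomp s a.
have {}hp : idspan (ws s) (a - (pi c%:MP + \sum_(j | side j == s) psi j (p j))).
  apply: idspan_sub hp => y; have [e [ews _ res _]] := wsP s.
  rewrite mem_cat => /orP[yw|]; last exact: res.
  by apply: idspan_mem; rewrite ews mem_cat yw.
have vanish y j : idspan (ws s) y -> side j = s -> phi j y = 0.
  case=> d -> js; rewrite raddf_sum big1 // => i _; rewrite /= rmorphM /=.
  by have [_ ->] := ws_mem (@mem_nth _ 0 (ws s) _ (ltn_ord i)); rewrite ?mulr0.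
have phia j : side j = s -> phi j a = c%:MP + p j.
  move=> js; apply/eqP; rewrite -subr_eq0 -(vanish _ j hp js) rmorphB rmorphD /=.
  by rewrite phiC phi_sum_psi.
have [j0 j0s] := side_ne s.
(* [kill] preserves constant terms, and side [s] contains at least one line. *)
have c0 : c = 0.
  have := congr1 (mcoeff 0%MM) (h j0 j0s); rewrite cst_kill phia // mcoeff0.
  by rewrite raddfD /= p0 addr0 mpolyCK.
rewrite -[a](subrK (pi c%:MP + \sum_(j | side j == s) psi j (p j))).
apply: idspanD.
  by apply: idspan_sub hp => y yw; apply: idspan_mem; rewrite mem_cat yw.
rewrite c0 mpolyC0 rmorph0 add0r.
apply: (@mspan_sum _ A^o) => j /eqP js.
have := h j js; rewrite phia // c0 mpolyC0 add0r => kp.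
(* Killing the variables selected by [zs] changes [psi j (p j)] only by a combination of the
   corresponding [x j b]. *)
rewrite -[psi j _]subr0 -(raddf0 (psi j)) -kp.
pose T : pred 'I_2 := [pred b | (j, b) \in zs].
apply: (@rmorph_mpoly_mod _ _ _ (psi j) (psi j \o kill T)) => /= [d|b].
  by rewrite killC.
rewrite killX psiX; case: ifP => Tb; last by rewrite psiX subrr; apply: mspan0.
rewrite raddf0 subr0; apply: idspan_mem; rewrite mem_cat; apply/orP; right.
by apply/mapP; exists (j, b).
Qed.

Lemma span_wsP s a : idspan (ws s) a <-> forall j, side j = s -> phi j a = 0.
Proof.
rewrite -[ws s]cats0 (@span_killP s [::]) //; split=> h j js; have := h j js.
  by rewrite kill_id.
by rewrite kill_id.
Qed.

Definition all_xs s := [seq z : I * 'I_2 <- enum {: I * 'I_2} | side z.1 == s].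

Lemma on_side_all s : on_side s (all_xs s).
Proof. exact: filter_all. Qed.

(** With all coordinates of side [s] adjoined, only the constant term is tested, and it is the same
    on every line. *)
Lemma span_allP s i a : idspan (ws s ++ xs (all_xs s)) a <-> (phi i a)@_0 = 0.
Proof.
have mem j b : side j = s -> (j, b) \in all_xs s.
  by move=> js; rewrite mem_filter /= js eqxx mem_enum.
rewrite span_killP ?on_side_all //; split=> [h|h j js].
  have [j js] := side_ne s; have := h j js.
  rewrite kill_cst => [|b]; last exact: mem.
  by move/eqP; rewrite mpolyC_eq0 (cst_phi i j) => /eqP.
by rewrite kill_cst => [|b]; [rewrite (cst_phi j i) h mpolyC0|exact: mem].
Qed.

Lemma maximal_idealP i a : maximal_homog_ideal gr a <-> (phi i a)@_0 = 0.
Proof.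
split=> [[k [c [g [gP ->]]]]|].
  rewrite !raddf_sum big1 // => j _ /=; rewrite rmorphM cstM.
  by have [d d_gt0 /(phi_gr i)/(homog_cst d_gt0) ->] := gP j; rewrite mulr0.
rewrite -(span_allP (side i)) => -[c ->].
set l := _ ++ _; exists (size l), c, (fun i => l`_i); split=> // k.
exists 1%N => //; have := mem_nth 0 (ltn_ord k); rewrite -/l mem_cat.
by case/orP=> [/ws_mem[]//|/mapP[z _ ->]]; apply: gr_x.
Qed.

(** Coordinates are adjoined only after the whole of [ws s]. Repetitions are excluded, since a
    repeated entry would have the whole ring as colon ideal. *)
Definition quotient_seq ys := exists s, (exists k, ys = take k (ws s)) \/
  exists zs, [/\ on_side s zs, uniq zs & ys = ws s ++ xs zs].
Notation G := quotient_seq.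

Lemma G_take i ys : G ys -> G (take i ys).
Proof.
case=> s [[k ->]|[zs [zss zsu ->]]].
  by exists s; left; exists (minn i k); rewrite take_min.
have [ilt|ige] := ltnP i (size (ws s)).
  by exists s; left; exists i; rewrite takel_cat // ltnW.
exists s; right; exists (take (i - size (ws s)) zs); split.
- by apply/allP => z /mem_take; move: z; apply/allP.
- exact: take_uniq.
by rewrite take_cat ltnNge ige /= /xs map_take.
Qed.

Lemma G_gr ys y : G ys -> y \in ys -> gr 1%N y.
Proof.
case=> s [[k ->] /mem_take/ws_mem[]//|[zs [_ _ ->]]].
by rewrite mem_cat => /orP[/ws_mem[]//|/mapP[z _ ->]]; apply: gr_x.
Qed.

(** * The colon ideals *)

Lemma mulX_eq0 (p : P) b : p * 'X_b = 0 -> p = 0.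
Proof.
move/eqP; rewrite mulf_eq0 => /orP[/eqP//|/eqP/(congr1 (mcoeff U_(b)))].
by rewrite mcoeffX eqxx mcoeff0 => /eqP; rewrite oner_eq0.
Qed.

(** [w s 0] vanishes on side [s] and restricts to a nonzerodivisor on every opposite line. *)
Lemma colon_w0 s a : idspan [::] (a * w s 0) <-> idspan (ws (~~ s)) a.
Proof.
rewrite span_wsP (@mspan_nil A A^o); split=> [e j js|h].
  have := congr1 (phi j) e; rewrite rmorphM rmorph0 /= phi_w //.
  exact: mulX_eq0.
apply: phi_inj => j; rewrite rmorphM rmorph0 /=.
have [/eqP js|js] := boolP (side j == s); first by rewrite phi_w0 // mulr0.
by rewrite h ?mul0r //; move: js; case: (side j) (s) => [] [].
Qed.

Definition x0s s :=
  [seq z : I * 'I_2 <- enum {: I * 'I_2} | (side z.1 == s) && (z.2 == 0)].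

Lemma on_side_x0s s : on_side s (x0s s).
Proof. by apply/allP => z; rewrite mem_filter => /andP[/andP[]]. Qed.

(** On each line opposite to [s], [X_0] divides [a * X_1] exactly when it divides [a]. *)
Lemma colon_w1 s a :
  idspan [:: w s 0] (a * w s 1) <-> idspan (ws (~~ s) ++ xs (x0s (~~ s))) a.
Proof.
rewrite span_killP ?on_side_x0s //.
have memE j b : side j = ~~ s -> ((j, b) \in x0s (~~ s)) = (b == 0).
  by move=> js; rewrite mem_filter /= js eqxx mem_enum andbT.
split=> [[c] e j js|h].
  have := congr1 (phi j) e; rewrite big_ord1 /= rmorphM phi_w // rmorphM /= phi_w //.
  move=> /(congr1 (kill [pred b | (j, b) \in x0s (~~ s)])).
  by rewrite !rmorphM /= !killX /= !memE // eqxx mulr0; apply: mulX_eq0.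
have hq j : exists q : P, side j = ~~ s -> phi j a = q * 'X_0.
  have [/eqP js|js] := boolP (side j == ~~ s); last by exists 0 => /eqP; rewrite (negPf js).
  have := kill_span (l := [:: 'X_0]) (h j js).
  case=> [b /=|c]; first by rewrite memE // inE => /eqP ->.
  by rewrite big_ord1 /= => e; exists (c 0%N).
have [q qP] := choice hq.
(* The factor [X_1] removes constant terms, so the summands glue. *)
exists (fun=> \sum_(j | side j == ~~ s) psi j (q j * 'X_1)); rewrite big_ord1 /=.
apply: phi_inj => j.
rewrite [LHS]rmorphM [RHS]rmorphM /=.
have [/eqP js|js] := boolP (side j == s); first by rewrite !phi_w0 // !mulr0.
have {}js : side j = ~~ s by move: js; case: (side j) (s) => [] [].
rewrite phi_sum_psi // => [|i _]; last first.
  by rewrite cstM mcoeffX -mdeg_eq0 mdeg1 mulr0.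
by rewrite !phi_w // qP // mulrAC.
Qed.

(** If [a] has no constant term, its product with a residue vanishes on side [s] and lies in the
    square of the irrelevant ideal on the other lines, hence in the ideal of [w2 s]. *)
Lemma colon_w s k i a : (1 < k < size (ws s))%N ->
  idspan (take k (ws s)) (a * (ws s)`_k) <-> (phi i a)@_0 = 0.
Proof.
have [e [ews _ _ eP]] := wsP s.
case: k => [|[|k]] // klt; have [] := ws_mem (mem_nth 0 klt).
move: klt; rewrite ews /= !ltnS; set y := e`_k => kle gry y0.
have w2P g : idspan (w2 s) g -> idspan (w2 s ++ take k e) g.
  by apply: idspan_sub => u uw; apply: idspan_mem; rewrite mem_cat uw.
have pos c : (phi i c)@_0 = 0 -> idspan (w2 s ++ take k e) (c * y).
  move=> c0; apply: w2P; apply: span_w2 => j js; rewrite rmorphM /=.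
    by rewrite y0 ?mulr0.
  by apply: sqmaxM; rewrite ?(cst_phi j i) // (homog_cst _ (phi_gr i gry)).
split; last exact: pos.
(* A nonzero constant term [c] would put [c y = (c - a) y + a y], hence [y], in the ideal of the
   predecessors, against irredundancy. *)
move=> ay; apply/eqP/negP => /negP c0; apply: (eP k kle); rewrite -/y.
set c := (phi i a)@_0 in c0.
have cy : idspan (w2 s ++ take k e) ((pi c%:MP - a) * y).
  by apply: pos; rewrite rmorphB /= phiC raddfB /= mpolyCK subrr.
have := idspanM (pi c^-1%:MP) (idspanD cy ay).
by rewrite -mulrDl subrK mulrA -rmorphM -mpolyCM mulVf // mpolyC1 rmorph1 mul1r.
Qed.

(** Within side [s], [x j b] is nonzero only on line [j], where the ideal is a prime generated by
    variables other than [X_b]. On the remaining lines of the side the new list tests only the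
    constant term, which line [j] already forces to vanish. *)
Lemma colon_x s zs j b a : on_side s zs -> side j = s -> (j, b) \notin zs ->
  idspan (ws s ++ xs zs) (a * x j b) <->
  idspan (ws s ++ xs [seq z <- all_xs s | (z.1 != j) || (z \in zs)]) a.
Proof.
move=> zss js jb; rewrite !span_killP //; last first.
  by apply/allP => z; rewrite mem_filter => /andP[_]; move: z; apply/allP/on_side_all.
set zs' := filter _ _.
have mem i c : side i = s -> ((i, c) \in zs') = (i != j) || ((i, c) \in zs).
  by move=> is_; rewrite mem_filter mem_filter mem_enum /= is_ eqxx !andbT.
have -> : (forall i, side i = s -> kill [pred c | (i, c) \in zs'] (phi i a) = 0) <->
          kill [pred c | (j, c) \in zs] (phi j a) = 0.
  have eT : [pred c | (j, c) \in zs'] = [pred c | (j, c) \in zs] :> pred _.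
    by apply/funext => c; rewrite /= mem // eqxx.
  split=> [/(_ j js)|h i is_]; first by rewrite eT.
  have [->|ij] := eqVneq i j; first by rewrite eT.
  rewrite kill_cst => [|c]; last by rewrite /= mem // ij.
  rewrite (cst_phi i j) -(cst_kill [pred c | (j, c) \in zs]) h mcoeff0.
  exact: mpolyC0.
split=> [/(_ j js)|h i is_].
  rewrite rmorphM /= phi_x rmorphM /= killX /= (negPf jb); exact: mulX_eq0.
rewrite rmorphM /=; have [->|ij] := eqVneq i j; first by rewrite rmorphM /= h mul0r.
by rewrite phi_x0 ?js // 1?eq_sym // mulr0 rmorph0.
Qed.

Lemma G_quot ys : G ys -> linear_quotients (V := A^o) G ys.
Proof.
have Gws s k : G (take k (ws s)) by exists s; left; exists k.
have Gws0 s : G (ws s) by rewrite -[ws s]take_size.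
have Gxs s zs : on_side s zs -> uniq zs -> G (ws s ++ xs zs).
  by move=> h1 h2; exists s; right; exists zs.
have uniq_filter (p : pred (I * 'I_2)) : uniq [seq z <- enum {: I * 'I_2} | p z].
  by apply: filter_uniq; apply: enum_uniq.
have colon s i : (i < size (ws s))%N -> exists2 zs, G zs &
    forall a, idspan (take i (ws s)) (a * (ws s)`_i) <-> idspan zs a.
  have [e [ews _ _ _]] := wsP s.
  (* Positions 0 and 1 hold [w s 0] and [w s 1]; all later entries are residues. *)
  case: i => [|[|i]] ilt.
  - exists (ws (~~ s)) => // a; rewrite take0 ews; exact: colon_w0.
  - exists (ws (~~ s) ++ xs (x0s (~~ s))).
      by apply: Gxs (on_side_x0s _) _; apply: uniq_filter.
    by move=> a; rewrite ews /= ?take0; apply: colon_w1.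
  exists (ws s ++ xs (all_xs s)).
    by apply: Gxs (on_side_all _) _; apply: uniq_filter.
  have [j _] := side_ne s.
  by move=> a; rewrite (colon_w j) // (span_allP s j).
case=> s [[k ->] i|[zs [zss zsu ->]] i].
  rewrite size_take_min leq_min => /andP[ik ilt].
  have [us Gus usP] := colon s i ilt; exists us => // a.
  by rewrite take_takel ?(ltnW ik) // nth_take //; apply: usP.
rewrite size_cat => ilt; have [is_|si] := ltnP i (size (ws s)).
  have [us Gus usP] := colon s i is_; exists us => // a.
  by rewrite takel_cat ?(ltnW is_) // nth_cat is_; apply: usP.
have [t et] : exists t, i = (size (ws s) + t)%N.
  by exists (i - size (ws s))%N; rewrite subnKC.
move: ilt; rewrite {i si}et ltn_add2l /xs size_map => tlt.
have [z0 _] : exists z : I * 'I_2, true by case: (zs) tlt => // z; exists z.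
set z := nth z0 zs t.
have zzs : z \in zs by apply: mem_nth.
have /eqP zs_ := allP zss _ zzs.
exists (ws s ++ xs [seq u <- all_xs s | (u.1 != z.1) || (u \in take t zs)]).
  apply: Gxs; last by do 2!apply: filter_uniq; apply: enum_uniq.
  by apply/allP => u; rewrite mem_filter => /andP[_]; move: u; apply/allP/on_side_all.
move=> a; rewrite take_cat nth_cat ltnNge leq_addr /= addKn -map_take.
rewrite (nth_map z0) //; apply: (@colon_x s (take t zs) z.1 z.2) => //.
  by apply/allP => u /mem_take; move: u; apply/allP.
rewrite -surjective_pairing; move: zsu.
by rewrite -{1}(cat_take_drop t zs) (drop_nth z0 tlt) cat_uniq => /and3P[_ /=];
  rewrite negb_or => /andP[].
Qed.

Theorem lines_koszul_filtration :
  (exists F, koszul_filtration gr F) /\ koszul gr.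
Proof.
have [i _] := side_ne true.
pose ys := ws true ++ xs (all_xs true).
have Gys : G ys.
  exists true; right; exists (all_xs true); split=> //; first exact: on_side_all.
  by apply: filter_uniq; apply: enum_uniq.
have ysP a : maximal_homog_ideal gr a <-> idspan ys a.
  by rewrite (maximal_idealP i) (span_allP true i).
have [p [pD pM gr_p p_id]] := graded_projection.
split.
  eexists;
    exact (koszul_filtration_of_linear_quotients G_gr G_quot G_take Gys ysP).
exact (koszul_of_linear_quotients (pD 2) pM (gr_p 1%N) (p_id 1%N) (gr0 1)
  G_gr G_quot Gys ysP).
Qed.

End Filtration.

(** * Genericity *)

Definition fin_mx (R : Type) (T : finType) (F : T -> T -> R) : 'M[R]_#|T| :=
  \matrix_(i, j) F (enum_val i) (enum_val j).

Lemma mul_fin_mx (F : comNzRingType) (T : finType) (f : T -> T -> F) (v : T -> F) j :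
  ((\row_i v (enum_val i)) *m fin_mx f) 0 j = \sum_s v s * f s (enum_val j).
Proof.
rewrite mxE (reindex _ (onW_bij _ (@enum_rank_bij T))).
by apply: eq_bigr => s _; rewrite !mxE enum_rankK.
Qed.

Lemma fin_mx_det_neq0 (F : fieldType) (T : finType) (f : T -> T -> F) :
  \det (fin_mx f) != 0 <->
  forall v : T -> F, (forall t, \sum_s v s * f s t = 0) -> forall s, v s = 0.
Proof.
split=> [d0 v hv s|h].
  have v0 : (\row_i v (enum_val i)) *m fin_mx f = 0.
    by apply/rowP => j; rewrite mul_fin_mx mxE hv.
  apply/eqP; apply: contraNT d0 => vs; apply/det0P.
  exists (\row_i v (enum_val i)) => //; apply: contraNneq vs.
  by move/rowP/(_ (enum_rank s)); rewrite !mxE enum_rankK => ->.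
apply/det0P => -[v /negP nz v0]; apply: nz; apply/eqP/rowP => i; rewrite [RHS]mxE.
rewrite -(enum_valK i); apply: (h (fun s => v 0 (enum_rank s))) => t.
have := mul_fin_mx f (fun s => v 0 (enum_rank s)) (enum_rank t).
rewrite enum_rankK => <-; set v' := \row_i _.
rewrite (_ : v' = v) ?v0 ?mxE //; by apply/rowP => j; rewrite mxE enum_valK.
Qed.

Section Genericity.
Variables (m n s : nat) (c : 'I_s -> 'I_m).
Hypothesis n_gt0 : (0 < n)%N.
Hypothesis c_inj : injective c.
Hypothesis s_small : (s.*2 <= n.+1)%N.
Notation coefs := ('I_m * 'I_n.-1 * 'I_n.+1)%type.

(* The square linear system expressing that vectors u_k, one on each of the
   lines c k, have a sum with vanishing first 2s coordinates: for each k there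
   are n - 1 equations of the line and the coordinates 2k and 2k + 1. *)
Definition incidence (R : pzRingType) (a : coefs -> R) (p q : 'I_s * 'I_n.+1) : R :=
  if insub (val q.2) is Some l then (p.1 == q.1)%:R * a (c q.1, l, p.2)
  else (p.2 == (q.1).*2 + (q.2 - n.-1) :> nat)%N%:R.

Lemma incidence_sum (R : pzRingType) (a : coefs -> R) (v : 'I_s * 'I_n.+1 -> R) k :
  (forall l : 'I_n.-1, \sum_p v p * incidence a p (k, inord l) =
     \sum_j v (k, j) * a (c k, l, j)) /\
  (forall b, (b < 2)%N -> \sum_p v p * incidence a p (k, inord (n.-1 + b)) =
     \sum_k' v (k', inord (k.*2 + b))).
Proof.
have ks : (k.*2.+1 < s.*2)%N by have := ltn_ord k; lia.
have pairE (f : 'I_s * 'I_n.+1 -> R) : \sum_p f p = \sum_k' \sum_j f (k', j).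
  by rewrite pair_bigA; apply: eq_bigr => -[].
split=> [l|b b2].
  rewrite pairE.
  have il : val (inord l : 'I_n.+1) = l :> nat.
    by rewrite /= inordK //; have := ltn_ord l; lia.
  rewrite (bigD1 k) //= [X in _ + X]big1 ?addr0 => [|k' kk].
    by apply: eq_bigr => j _; rewrite /incidence /= il valK eqxx mul1r.
  by apply: big1 => j _; rewrite /incidence /= il valK (negPf kk) mul0r mulr0.
rewrite pairE.
apply: eq_bigr => k' _; rewrite (bigD1 (inord (k.*2 + b))) //= [X in _ + X]big1 => [|j jk].
  rewrite addr0 /incidence /= insubF ?inordK; try lia.
  by rewrite (_ : _ == _ = true) ?mulr1 //; lia.
rewrite /incidence /= insubF ?inordK; try lia.
rewrite (_ : _ == _ = false) ?mulr0 //; apply: contraNF jk => /eqP jk.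
by apply/eqP/val_inj; rewrite /= inordK; lia.
Qed.

(* At these coefficients the line c k is spanned by the coordinate points
   2k and 2k + 1. *)
Definition coordinate_lines (t : coefs) : rat :=
  [exists k, (c k == t.1.1) &&
     (t.2 == (if (t.1.2 < k.*2)%N then t.1.2 : nat else t.1.2.+2) :> nat)]%:R.

(** The line equations kill the coordinates of the vector [k] outside positions 2k and 2k+1; in
    those positions the sum over all vectors has a single term left. *)
Lemma incidence_coordinate_lines : \det (fin_mx (incidence coordinate_lines)) != 0.
Proof.
apply/fin_mx_det_neq0 => v hv.
have off (k : 'I_s) (j : 'I_n.+1) : (j < k.*2)%N || (k.*2.+1 < j)%N -> v (k, j) = 0.
  move=> hj; have ks : (k.*2.+1 < s.*2)%N by have := ltn_ord k; lia.
  have jn := ltn_ord j.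
  (* The equation isolating coordinate [j]; the numbering of equations skips 2k and 2k+1. *)
  pose l := (if (j < k.*2)%N then j : nat else j - 2)%N.
  have hl : (l < n.-1)%N by rewrite /l; case: ifP; lia.
  have lj : (if (l < k.*2)%N then l else l.+2) = j :> nat.
    by rewrite /l; case: (ltnP j k.*2) hj => h1 h2; case: ltnP; lia.
  have [/(_ (Ordinal hl)) h _] := incidence_sum coordinate_lines v k.
  move: h; rewrite hv (bigD1 j) //= [X in _ + X]big1 => [|i ij].
    rewrite addr0 /coordinate_lines (_ : [exists _, _]) ?mulr1 //.
    by apply/existsP; exists k; rewrite eqxx /= lj.
  rewrite /coordinate_lines (_ : [exists _, _] = false) ?mulr0 //.
  apply/existsP => -[k' /andP[/eqP/c_inj -> /eqP /= e]].
  by move/eqP: ij; apply; apply: val_inj; rewrite /= e lj.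
case=> k j; have [/off //|] := boolP ((j < k.*2) || (k.*2.+1 < j))%N.
rewrite negb_or -!leqNgt => jk.
have b2 : (j - k.*2 < 2)%N by lia.
have [_ /(_ _ b2)] := incidence_sum coordinate_lines v k.
rewrite hv subnKC ?inord_val; last by case/andP: jk.
rewrite (bigD1 k) //= big1 ?addr0 // => k' kk; apply: off.
have : (k' != k :> nat) by []. lia.
Qed.

(** The determinant is the value at [a] of a rational polynomial, nonzero because it does not vanish
    at the coordinate lines; algebraic independence then forbids a zero value. *)
Lemma generic_incidence (K : numFieldType) (a : 'I_m -> 'M[K]_(n.-1, n.+1)) :
  alg_independent_over_rat (fun t : coefs => a t.1.1 t.1.2 t.2) ->
  \det (fin_mx (incidence (fun t => a t.1.1 t.1.2 t.2))) != 0.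
Proof.
move=> ai; set b := fun t : coefs => _.
(* Indeterminate coefficients, specialized below both to [a] and to the coordinate lines. *)
pose X (t : coefs) : {mpoly rat[#|{: coefs}|]} := 'X_(enum_rank t).
have det_map (R S : comNzRingType) (f : {rmorphism R -> S}) (g : coefs -> R) :
    f (\det (fin_mx (incidence g))) = \det (fin_mx (incidence (f \o g))).
  rewrite -det_map_mx; congr (\det _); apply/matrixP => i j; rewrite !mxE /incidence.
  by case: insubP => [l _ _|_]; rewrite ?rmorphM rmorph_nat.
have mapX (S : comNzRingType) (f : {rmorphism rat -> S}) (g : coefs -> S) :
    mmap f (fun i => g (enum_val i)) (\det (fin_mx (incidence X))) =
    \det (fin_mx (incidence g)).
  rewrite (det_map _ _ (mmap f (fun i => g (enum_val i)))).
  congr (\det (fin_mx (incidence _))); apply/funext => t /=.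
  by rewrite mmapX mmap1U enum_rankK.
apply/eqP => d0; have := incidence_coordinate_lines.
rewrite -(mapX _ idfun) (ai (\det (fin_mx (incidence X)))) ?rmorph0 ?eqxx //.
by rewrite -d0 -(mapX _ ratr).
Qed.

(** Geometrically, the planes over the [s] lines remain independent after projection to the first 2s
    coordinates. *)
Lemma generic_independent (K : numFieldType) (a : 'I_m -> 'M[K]_(n.-1, n.+1))
    (u : 'I_s -> 'rV[K]_n.+1) :
    alg_independent_over_rat (fun t : coefs => a t.1.1 t.1.2 t.2) ->
    (forall k, u k *m (a (c k))^T = 0) ->
    (forall j : 'I_n.+1, (j < s.*2)%N -> \sum_k u k 0 j = 0) ->
  forall k, u k = 0.
Proof.
move=> /generic_incidence/fin_mx_det_neq0 h ua us k; apply/rowP => j; rewrite [RHS]mxE.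
apply: (h (fun p => u p.1 0 p.2) _ (k, j)) => -[{}k {}j].
have [h1 h2] := incidence_sum (fun t => a t.1.1 t.1.2 t.2) (fun p => u p.1 0 p.2) k.
have [jn|jn] := ltnP j n.-1.
  have := h1 (Ordinal jn); rewrite /= inord_val => ->.
  have /rowP/(_ (Ordinal jn)) := ua k; rewrite !mxE => e; apply: etrans e.
  by apply: eq_bigr => i _; rewrite mxE.
have ks : (k.*2.+1 < s.*2)%N by have := ltn_ord k; lia.
have b2 : (j - n.-1 < 2)%N by have := ltn_ord j; lia.
have := h2 _ b2; rewrite /= subnKC // inord_val => ->; apply: us.
by rewrite inordK; lia.
Qed.

End Genericity.

Lemma unitmx_of_ker (F : fieldType) k (A : 'M[F]_k) :
  (forall y : 'cV_k, A *m y = 0 -> y = 0) -> A \in unitmx.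
Proof.
move=> h; rewrite -unitmx_tr -row_free_unit; apply: inj_row_free => v e.
by apply: (can_inj trmxK); rewrite trmx0; apply: h; rewrite -[LHS]trmxK trmx_mul trmxK e trmx0.
Qed.

(** Stacking the [H k] gives an invertible matrix: the columns of a right inverse are the dual
    bases, and a left inverse gives joint injectivity. *)
Lemma independent_dual (F : fieldType) s N (H : 'I_s -> 'M[F]_(2, N)) :
    N = s.*2 ->
    (forall r : 'I_s -> 'rV_2, \sum_k r k *m H k = 0 -> forall k, r k = 0) ->
  (forall k, exists X : 'M_(N, 2), H k *m X = 1%:M /\
      forall k', k' != k -> H k' *m X = 0) /\
  (forall y : 'cV_N, (forall k, H k *m y = 0) -> y = 0).
Proof.
move=> eN h; pose T := ('I_s * 'I_2)%type.
pose D : 'M[F]_(#|{: T}|, N) := \matrix_(t, l) H (enum_val t).1 (enum_val t).2 l.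
have Dfree : row_free D.
  apply: inj_row_free => v vD.
  have r0 : \sum_k (\row_b v 0 (enum_rank ((k, b) : T))) *m H k = 0.
    apply/rowP => l; rewrite summxE -vD [RHS]mxE.
    rewrite [RHS](reindex _ (onW_bij _ (@enum_rank_bij T))).
    transitivity (\sum_k \sum_b v 0 (enum_rank ((k, b) : T)) * H k b l).
      by apply: eq_bigr => k _; rewrite mxE; apply: eq_bigr => b _; rewrite mxE.
    by rewrite pair_bigA; apply: eq_bigr => -[k b] _; rewrite mxE enum_rankK.
  apply/rowP => t; rewrite -(enum_valK t) [RHS]mxE; case: (enum_val t) => k b.
  by have /rowP/(_ b) := h _ r0 k; rewrite !mxE.
have [B DB] := row_freeP Dfree; split=> [k|y hy].
  have DBE k' b b' : (H k' *m (\matrix_(l, b) B l (enum_rank ((k, b) : T)))) b' b =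
                     (((k', b') : T) == (k, b))%:R.
    have /matrixP/(_ (enum_rank ((k', b') : T)) (enum_rank ((k, b) : T))) := DB.
    rewrite !mxE (inj_eq enum_rank_inj) => <-.
    by apply: eq_bigr => l _; rewrite !mxE enum_rankK.
  exists (\matrix_(l, b) B l (enum_rank ((k, b) : T))); split=> [|k' kk].
    by apply/matrixP => b' b; rewrite DBE mxE xpair_eqE eqxx.
  by apply/matrixP => b' b; rewrite DBE [RHS]mxE xpair_eqE (negPf kk).
have Dfull : row_full D.
  by rewrite /row_full (eqnP Dfree) card_prod !card_ord eN muln2.
have [C CD] := row_fullP Dfull.
rewrite -[y]mul1mx -CD -mulmxA (_ : D *m y = 0) ?mulmx0 //.
apply/matrixP => t o; have /matrixP/(_ (enum_val t).2 o) := hy (enum_val t).1.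
rewrite !mxE => e; apply: etrans e; by apply: eq_bigr => l _; rewrite mxE.
Qed.

(** * Restriction of polynomials to a line *)

Section Pullback.
Variables (K : fieldType) (n : nat).
Implicit Types (E : 'M[K]_(2, n.+1)) (L : line K n).

Definition line_basis L E :=
  [/\ forall r : 'rV_2, r *m E \in line_space L,
      forall v, v \in line_space L -> exists r : 'rV_2, v = r *m E
    & forall r : 'rV_2, r *m E = 0 -> r = 0].

Lemma ex_line_basis L : exists E, line_basis L E.
Proof.
move: (vbasis (line_space L)) (vbasisP (line_space L)).
rewrite dim_line_space => X bX.
exists (\matrix_(b < 2) X`_b).
have mulE (r : 'rV[K]_2) :
    r *m (\matrix_(b < 2) X`_b) = \sum_(b < 2) r 0 b *: X`_b.
  by rewrite mulmx_sum_row; apply: eq_bigr => b _; rewrite rowK.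
split=> [r|v vL|r].
- rewrite mulE; apply: rpred_sum => b _; apply: rpredZ; apply: (basis_mem bX).
  by apply: mem_nth; rewrite size_tuple.
- exists (\row_b coord X b v); rewrite mulE {1}(coord_basis bX vL).
  by apply: eq_bigr => b _; rewrite mxE.
rewrite mulE => r0; apply/rowP => b; rewrite [RHS]mxE.
by have /freeP := basis_free bX; apply.
Qed.

Lemma line_basisM L E (B : 'M_2) :
  B \in unitmx -> line_basis L E -> line_basis L (B *m E).
Proof.
move=> uB [h1 h2 h3]; split=> [r|v /h2[r ->]|r].
- by rewrite mulmxA.
- by exists (r *m invmx B); rewrite mulmxA mulmxKV.
by rewrite mulmxA => /h3 /(congr1 (mulmxr (invmx B))); rewrite /= mulmxK // mul0mx.
Qed.

(** Composition with the parametrization of the line by [r *m E]. *)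
Definition line_pullback E : {mpoly K[n.+1]} -> {mpoly K[2]} :=
  mmap (@mpolyC 2 K) (fun l => \sum_b E b l *: 'X_b).
HB.instance Definition _ E := GRing.RMorphism.copy (line_pullback E)
  (mmap (@mpolyC 2 K) (fun l => \sum_b E b l *: 'X_b)).

Lemma line_pullbackC E c : line_pullback E c%:MP = c%:MP.
Proof. exact: mmapC. Qed.

Lemma line_pullbackX E l : line_pullback E 'X_l = \sum_b E b l *: 'X_b.
Proof. by rewrite /line_pullback mmapX mmap1U. Qed.

Lemma line_pullbackX_homog E l : line_pullback E 'X_l \is 1.-homog.
Proof.
by rewrite line_pullbackX; apply: rpred_sum => b _; rewrite rpredZ // dhomogX /= mdeg1.
Qed.

Lemma line_pullback_linear_form E v :
  line_pullback E (linear_form v) = linear_form (v *m E^T).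
Proof.
rewrite /linear_form raddf_sum /=.
under eq_bigr => l _ do rewrite -mul_mpolyC rmorphM /= line_pullbackC line_pullbackX mulr_sumr.
rewrite exchange_big; apply: eq_bigr => b _; rewrite mxE scaler_suml.
by apply: eq_bigr => l _; rewrite mul_mpolyC scalerA mxE.
Qed.

Lemma meval_pullback E (r : 'rV_2) f :
  f.@[fun j => (r *m E) 0 j] = (line_pullback E f).@[fun b => r 0 b].
Proof.
apply: (@rmorph_mpoly_eq _ _ _ (meval _) (meval (fun b => r 0 b) \o line_pullback E)).
  by move=> c /=; rewrite line_pullbackC !mevalC.
move=> l /=; rewrite line_pullbackX mevalXU mxE raddf_sum.
by apply: eq_bigr => b _; rewrite /= mevalZ mevalXU mulrC.
Qed.

Lemma meval_linear_form (u v : 'rV[K]_n.+1) :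
  (linear_form u).@[fun j => v 0 j] = \sum_j u 0 j * v 0 j.
Proof.
rewrite /linear_form raddf_sum /=; apply: eq_bigr => j _.
by rewrite mevalZ mevalXU.
Qed.

Lemma line_equations L k (a : 'M[K]_(k, n.+1)) v :
    line_ideal L = ideal_gen [set linear_form (row l a) | l in [set: 'I_k]]%classic ->
  v \in line_space L -> v *m a^T = 0.
Proof.
move=> eL vL; have [->|v0] := eqVneq v 0; first by rewrite mul0mx.
apply/rowP => l; rewrite !mxE.
have : line_ideal L (linear_form (row l a)).
  rewrite eL; exists 1%N, (fun=> 1), (fun=> linear_form (row l a)).
  by split=> [i|]; [exists l|rewrite big_ord1 mul1r].
case=> p [c [g [hg e]]]; have := congr1 (meval (fun j => v 0 j)) e.
rewrite meval_linear_form raddf_sum [RHS]big1 /= => [e0|i _].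
  by apply: etrans e0; apply: eq_bigr => j _; rewrite !mxE mulrC.
by rewrite mevalM (hg i).2 ?mulr0.
Qed.

(** Linear generators pull back to 0 because the basis vectors satisfy the line equations.
    Conversely, if [f] pulls back to 0, so does each homogeneous component, which therefore vanishes
    at all points of the line. *)
Lemma line_ideal_pullback L E k (a : 'M[K]_(k, n.+1)) f :
    line_ideal L = ideal_gen [set linear_form (row l a) | l in [set: 'I_k]]%classic ->
  line_basis L E -> line_ideal L f <-> line_pullback E f = 0.
Proof.
move=> eL [E1 E2 _]; split=> [|f0].
  rewrite eL => -[p [c [g [hg ->]]]]; rewrite raddf_sum big1 // => i _.
  have [l _ <-] := hg i; rewrite /= rmorphM /= line_pullback_linear_form.
  rewrite (_ : _ *m _ = 0) => [|].
    by rewrite /linear_form big1 ?mulr0 // => b _; rewrite mxE scale0r.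
  have h (r : 'rV_2) := line_equations eL (E1 r).
  apply/rowP => b; have /rowP/(_ l) := h (delta_mx 0 b).
  rewrite -rowE !mxE => e; apply: etrans e.
  by apply: eq_bigr => j _; rewrite !mxE mulrC.
have [e _ ef] := mpoly_homog_split f 0.
exists e, (fun=> 1), (fun d : 'I_e => pihomog mdeg d f); split=> [d|]; last first.
  by rewrite {1}ef; apply: eq_bigr => d _; rewrite mul1r.
split=> [|v /E2[r ->] _]; first by exists d; apply: pihomogP.
rewrite meval_pullback (@rmorph_pihomog _ _ _ (line_pullback E)) => [|c|l].
- by rewrite /= f0 pihomog0 meval0.
- exact: line_pullbackC.
exact: line_pullbackX_homog.
Qed.

End Pullback.

(** * Morphisms out of a quotient ring *)

Section QuotientLift.
Variables (R S : comNzRingType) (J : idealr R) (f : {rmorphism R -> S}).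

Definition quot_lift & (forall x, x \in J -> f x = 0) : {ideal_quot J} -> S :=
  fun x => f (repr x).

Hypothesis fJ : forall x, x \in J -> f x = 0.

Lemma quot_lift_pi x : quot_lift fJ (\pi x) = f x.
Proof.
apply/eqP; rewrite -subr_eq0 -rmorphB; apply/eqP/fJ.
by rewrite Quotient.idealrBE reprK.
Qed.

Lemma quot_lift_zmod_morphism : zmod_morphism (quot_lift fJ).
Proof.
move=> x y; rewrite -[x]reprK -[y]reprK -rmorphB !quot_lift_pi.
exact: rmorphB.
Qed.

Lemma quot_lift_monoid_morphism : monoid_morphism (quot_lift fJ).
Proof.
split=> [|x y].
  by rewrite -(rmorph1 (\pi_{ideal_quot J})) quot_lift_pi rmorph1.
by rewrite -[x]reprK -[y]reprK -rmorphM !quot_lift_pi rmorphM.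
Qed.

End QuotientLift.

HB.instance Definition _ (R S : comNzRingType) (J : idealr R)
    (f : {rmorphism R -> S}) (fJ : forall x, x \in J -> f x = 0) :=
  GRing.isZmodMorphism.Build {ideal_quot J} S (quot_lift fJ)
    (quot_lift_zmod_morphism fJ).
HB.instance Definition _ (R S : comNzRingType) (J : idealr R)
    (f : {rmorphism R -> S}) (fJ : forall x, x \in J -> f x = 0) :=
  GRing.isMonoidMorphism.Build {ideal_quot J} S (quot_lift fJ)
    (quot_lift_monoid_morphism fJ).

(** * Adapted linear forms on generic lines *)

Section GenericLines.
Variables (K : numFieldType) (m n : nat) (M : 'I_m -> line K n).
(** The first bound makes both halves nonempty; the second leaves room for the larger half together
    with one more line. *)
Hypothesis m_ge2 : (2 <= m)%N.
Hypothesis n_large : ((uphalf m).+1.*2 <= n.+1)%N.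
Hypothesis genM : generic_collection M.

Definition truncate (N : nat) : 'M[K]_(n.+1, N) := \matrix_(j, l) (j == l :> nat)%:R.

(** Linear forms in the first [#|C|.*2] variables can be chosen dual to the lines of [C], and are
    determined by their restrictions to these lines. *)
Lemma generic_dual (E : 'I_m -> 'M[K]_(2, n.+1)) (C : {set 'I_m})
    (Q := truncate #|C|.*2) :
    (forall i, line_basis (M i) (E i)) -> (#|C|.*2 <= n.+1)%N ->
  (forall i, i \in C -> exists X, E i *m Q *m X = 1%:M :> 'M_2 /\
      forall j, j \in C -> j != i -> E j *m Q *m X = 0) /\
  (forall y : 'cV_ _, (forall i, i \in C -> E i *m Q *m y = 0) -> y = 0).
Proof.
move=> EP Cn; have [a [ai aM]] := genM.
pose c := @enum_val _ (mem C).
have cC k : c k \in C by apply: enum_valP.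
have n_gt0 : (0 < n)%N by lia.
have indep (r : 'I_#|C| -> 'rV_2) :
    \sum_k r k *m (E (c k) *m Q) = 0 -> forall k, r k = 0.
  move=> r0 k; have [_ _] := EP (c k); apply.
  apply: (generic_independent n_gt0 (@enum_val_inj _ (mem C)) Cn ai
    (u := fun k => r k *m E (c k))) => [k'|j jC].
    apply: (line_equations (aM (c k'))); by have [] := EP (c k').
  have /rowP/(_ (Ordinal jC)) := r0; rewrite summxE [RHS]mxE => e; apply: etrans e.
  apply: eq_bigr => k' _; rewrite mulmxA [RHS]mxE (bigD1 j) //= [Q _ _]mxE /= eqxx mulr1.
  rewrite big1 ?addr0 // => i /negPf ij.
  by rewrite [Q _ _]mxE /= (_ : _ == _ = false) ?mulr0.
have [h1 h2] := independent_dual erefl indep; split=> [i iC|y hy].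
  have [X [X1 X0]] := h1 (enum_rank_in iC i); exists X.
  rewrite -[X in E X](enum_rankK_in iC iC); split=> // j jC ji.
  rewrite -[X in E X](enum_rankK_in iC jC); apply: X0.
  by apply: contraNneq ji => /enum_rank_in_inj -> //.
by apply: h2 => k; apply: hy.
Qed.

Definition side (i : 'I_m) := (i < m./2)%N.

Definition side_set s := [set i | side i == s].

Lemma side_nonempty s : exists i, side i = s.
Proof.
have m2 := odd_double_half m.
case: s; rewrite /side.
  have h : (0 < m)%N by lia.
  by exists (Ordinal h) => /=; lia.
have h : (m.-1 < m)%N by lia.
by exists (Ordinal h) => /=; apply/negbTE; rewrite -leqNgt; lia.
Qed.

Lemma card_side s : (#|side_set s| <= uphalf m)%N.
Proof.
have m2 := odd_double_half m; have u2 := uphalf_half m.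
have cT : #|side_set true| = m./2.
  rewrite -sum1_card -[RHS]card_ord -sum1_card.
  rewrite (big_ord_widen m (fun=> 1%N)); last by lia.
  by apply: eq_bigl => i; rewrite inE eqb_id.
case: s; first by rewrite cT u2; lia.
have -> : side_set false = ~: side_set true.
  by apply/setP => i; rewrite !inE eqb_id; case: (side i).
have := cardsC (side_set true); rewrite cT card_ord; lia.
Qed.

Lemma side_set_add s i : side i = ~~ s -> #|i |: side_set s| = #|side_set s|.+1.
Proof. by move=> is_; rewrite cardsU1 inE is_; case: s {is_}. Qed.

(* The forms W_s vanish on one half of the lines.  They only involve the first
   2(#|side_set s| + 1) variables, which are coordinates on the span of that
   half and any line of the other half; so they line_pullback to a basis of the
   linear forms on every line of the other half simultaneously. *)
Lemma vanishing_forms (E : 'I_m -> 'M[K]_(2, n.+1)) s :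
    (forall i, line_basis (M i) (E i)) ->
  exists W : 'M_(n.+1, 2), (forall i, side i = s -> E i *m W = 0) /\
    forall i, side i = ~~ s -> E i *m W \in unitmx.
Proof.
move=> EP; have [i0 si0] := side_nonempty (~~ s).
pose N := (#|side_set s|.+1).*2; pose Q := truncate N.
have cs := card_side s.
have dual i : side i = ~~ s ->
   (forall k, k \in i |: side_set s -> exists X : 'M_(N, 2), E k *m Q *m X = 1%:M /\
      forall j, j \in i |: side_set s -> j != k -> E j *m Q *m X = 0) /\
   (forall y : 'cV_N, (forall k, k \in i |: side_set s -> E k *m Q *m y = 0) -> y = 0).
  move=> si; have := generic_dual (C := i |: side_set s) EP.
  by rewrite side_set_add // => /(_ _); apply; lia.
have [/(_ i0 (setU11 _ _)) [X [X1 X0]] _] := dual i0 si0.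
have Xs i : side i = s -> E i *m Q *m X = 0.
  move=> si; apply: X0; first by rewrite !inE si eqxx orbT.
  by apply/eqP => e; move: si; rewrite e si0; case: (s).
exists (Q *m X); split=> i si; rewrite mulmxA; first exact: Xs.
(* For [y] in the kernel, the form [X *m y] vanishes on line [i] and on side [s], hence is 0;
   duality on line [i0] gives [y = 0]. *)
apply: unitmx_of_ker => y y0.
have [_ h] := dual i si.
have Xy : X *m y = 0.
  apply: h => k; rewrite !inE => /orP[/eqP ->|/eqP sk]; first by rewrite mulmxA.
  by rewrite mulmxA Xs ?mul0mx.
by rewrite -[y]mul1mx -X1 -(mulmxA _ X y) Xy mulmx0.
Qed.

Lemma adapted_forms : exists (E : 'I_m -> 'M[K]_(2, n.+1))
    (W : bool -> 'M[K]_(n.+1, 2)) (X : 'I_m -> 'M[K]_(n.+1, 2)),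
  [/\ forall i, line_basis (M i) (E i),
      forall s i, side i = s -> E i *m W s = 0,
      forall s i, side i = ~~ s -> E i *m W s = 1%:M,
      forall i, E i *m X i = 1%:M
    & forall i j, i != j -> side i = side j -> E j *m X i = 0].
Proof.
have [E EP] := choice (fun i => ex_line_basis (M i)).
have [W WP] := choice (fun s => vanishing_forms s EP).
have dualX i : exists X : 'M_(n.+1, 2), E i *m X = 1%:M /\
    forall j, i != j -> side i = side j -> E j *m X = 0.
  have cs := card_side (side i).
  have iC : i \in side_set (side i) by rewrite inE.
  have Cn : (#|side_set (side i)|.*2 <= n.+1)%N by lia.
  have [/(_ i iC)[X [X1 X0]] _] := generic_dual EP Cn.
  exists (truncate _ *m X); rewrite mulmxA; split=> // j ij ij'.
  by rewrite mulmxA; apply: X0; rewrite ?inE ?ij' // eq_sym.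
have [X XP] := choice dualX.
(* Changing the basis of line [i] by the inverse of [B i] turns the restrictions of [W] into the
   coordinates; [X i] is multiplied by [B i] to stay dual. *)
pose B i := E i *m W (~~ side i).
have uB i : B i \in unitmx by apply: (WP _).2; rewrite negbK.
exists (fun i => invmx (B i) *m E i), W, (fun i => X i *m B i); split.
- by move=> i; apply: line_basisM; rewrite ?unitmx_inv.
- by move=> s i si; rewrite -mulmxA (WP s).1 ?mulmx0.
- by move=> s i si; rewrite -mulmxA -[s]negbK -si mulVmx.
- by move=> i; rewrite -mulmxA [E i *m _]mulmxA (XP i).1 mul1mx mulVmx.
- by move=> i j ij sij; rewrite -mulmxA [E j *m _]mulmxA (XP i).2 // mul0mx mulmx0.
Qed.

Lemma line_pullback_col (E : 'M[K]_(2, n.+1)) (Y : 'M[K]_(n.+1, 2)) b :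
  line_pullback E (linear_form (col b Y)^T) = linear_form (col b (E *m Y))^T.
Proof. by rewrite line_pullback_linear_form -trmx_mul !colE mulmxA. Qed.

Lemma linear_form_homog k (v : 'rV[K]_k.+1) : linear_form v \is 1.-homog.
Proof. by apply: rpred_sum => j _; rewrite rpredZ // dhomogX /= mdeg1. Qed.

Lemma linear_form0 k : linear_form (0 : 'rV[K]_k.+1) = 0.
Proof. by rewrite /linear_form big1 // => j _; rewrite mxE scale0r. Qed.

Lemma linear_form_col1 k b : linear_form (col b 1%:M : 'cV[K]_k.+1)^T = 'X_b.
Proof.
rewrite /linear_form (bigD1 b) //= !mxE eqxx scale1r big1 ?addr0 // => j jb.
by rewrite !mxE (negPf jb) scale0r.
Qed.

(** The ideal of the collection is the intersection of the kernels of the pullbacks, so restriction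
    to the lines is jointly injective on the quotient. *)
Lemma generic_lines_koszul (m_gt0 : (0 < m)%N) :
  (exists F, koszul_filtration (@coordinate_ring_gr _ _ _ m_gt0 M) F) /\
  koszul (@coordinate_ring_gr _ _ _ m_gt0 M).
Proof.
have [E [W [X [EP W0 W1 X1 X0]]]] := adapted_forms.
have [a [ai aM]] := genM.
pose J : idealr _ := collection_ideal m_gt0 M.
have JP f : (f \in J) <-> forall i, line_pullback (E i) f = 0.
  split=> [/asboolP h i|h]; first by apply/(line_ideal_pullback _ (aM i) (EP i)).
  by apply/asboolP => i; apply/(line_ideal_pullback _ (aM i) (EP i)).
have EJ i f : f \in J -> line_pullback (E i) f = 0 by move/JP.
pose pi : {rmorphism {mpoly K[n.+1]} -> {ideal_quot J}} := \pi_{ideal_quot J}.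
have piK y : pi (repr y) = y by apply: reprK.
pose phi i : {rmorphism {ideal_quot J} -> {mpoly K[2]}} := quot_lift (EJ i).
have phiE i f : phi i (pi f) = line_pullback (E i) f by apply: quot_lift_pi.
pose form (Y : 'M[K]_(n.+1, 2)) b := linear_form (col b Y)^T.
have := @lines_koszul_filtration K n.+1 {ideal_quot J} 'I_m pi phi _ _ _ _ side
  (fun s b => pi (form (W s) b)) (fun i b => pi (form (X i) b)).
apply.
- by move=> y; exists (repr y); rewrite piK.
- move=> y z yz; rewrite -[y]reprK -[z]reprK; apply/eqP.
  rewrite -Quotient.idealrBE; apply/JP => i; rewrite rmorphB /=.
  by rewrite -!phiE !piK yz subrr.
- by move=> i c; rewrite phiE line_pullbackC.
- by move=> i l; rewrite phiE line_pullbackX_homog.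
- exact: side_nonempty.
- by move=> s b; exists (form (W s) b) => //; apply: linear_form_homog.
- by move=> i b; exists (form (X i) b) => //; apply: linear_form_homog.
- by move=> s b i si; rewrite phiE line_pullback_col W0 // col0 trmx0 linear_form0.
- by move=> s b i si; rewrite phiE line_pullback_col W1 // linear_form_col1.
- by move=> i b; rewrite phiE line_pullback_col X1 linear_form_col1.
- by move=> i j b ij sij; rewrite phiE line_pullback_col X0 // col0 trmx0 linear_form0.
Qed.

End GenericLines.

Theorem theorem4p3 (Rl : realType) (m n : nat) (m_ge2 : (2 <= m)%N)
    (M : 'I_m -> line Rl[i] n) (genM : generic_collection M) :
  let gr := @coordinate_ring_gr _ m n (ltnW m_ge2) M in
  [/\ ~~ odd m -> (m + 1 <= n)%N -> exists F, koszul_filtration gr F,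
      odd m -> (m + 2 <= n)%N -> exists F, koszul_filtration gr F
    & (~~ odd m /\ (m + 1 <= n)%N) \/ (odd m /\ (m + 2 <= n)%N) -> koszul gr].
Proof.
move=> gr.
have main : (~~ odd m /\ (m + 1 <= n)%N) \/ (odd m /\ (m + 2 <= n)%N) ->
    (exists F, koszul_filtration gr F) /\ koszul gr.
  (* For either parity, the numerical condition is that twice the size of the larger half plus 2 is
     at most [n + 1]. *)
  move=> h; apply: generic_lines_koszul => //.
  have := uphalf_half m; have := odd_double_half m.
  by case: h => -[]; case: (odd m) => //= _; lia.
split.
- by move=> h1 h2; apply: (proj1 (main _)); left.
- by move=> h1 h2; apply: (proj1 (main _)); right.
- by move=> /main[].
Qed.
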